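(* The following decision problem (verification under set-stable semantics) is in $\mathsf{P}$: given a finite bipolar ABA framework $\mathcal{F}=(\mathcal{L},\mathcal{R},\mathcal{A},\overline{\phantom{a}})$ and $A\subseteq\mathcal{A}$, is $A$ a set-stable extension of $\mathcal{F}$?
   Context: An ABA framework is a tuple $(\mathcal{L},\mathcal{R},\mathcal{A},\overline{\phantom{a}})$ where $\mathcal{L}$ is a set of sentences; $\mathcal{R}$ is a set of rules $\varphi_0\leftarrow\varphi_1,\dots,\varphi_m$ with $m\ge 0$ and all $\varphi_i\in\mathcal{L}$ (head $\varphi_0$, body $\varphi_1,\dots,\varphi_m$; for $m=0$ written $\varphi_0\leftarrow\top$ with $\top\notin\mathcal{L}$); $\mathcal{A}\subseteq\mathcal{L}$ is a non-empty set of assumptions; and $\overline{\phantom{a}}:\mathcal{A}\to\mathcal{L}$ is a total map ($\overline{\alpha}$ is the contrary of $\alpha$). It is bipolar iff every rule is of the form $\varphi\leftarrow\alpha$ with $\alpha\in\mathcal{A}$ and either $\varphi\in\mathcal{A}$ or $\varphi=\overline{\beta}$ for some $\beta\in\mathcal{A}$. A deduction $A\vdash^{R}\varphi$ for $\varphi\in\mathcal{L}$ supported by $A\subseteq\mathcal{A}$ and $R\subseteq\mathcal{R}$ is a finite tree with root labelled $\varphi$; leaves labelled by $\top$ or assumptions, with $A$ the set of all assumptions labelling leaves; and the children of each non-leaf labelled $\psi$ labelled by the elements of the body of some rule in $\mathcal{R}$ with head $\psi$, with $R$ the set of all rules so used. For $A,B\subseteq\mathcal{A}$: $A$ attacks $B$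 if there is a deduction $A'\vdash^{R}\overline{\beta}$ with $\beta\in B$, $A'\subseteq A$, $R\subseteq\mathcal{R}$. $Cl(A)=\{\alpha\in\mathcal{A}:\exists\, A'\vdash^{R}\alpha,\ A'\subseteq A,\ R\subseteq\mathcal{R}\}$; $A$ is closed iff $A=Cl(A)$; $A$ is conflict-free iff $A$ does not attack $A$. $A$ is set-stable iff it is closed, conflict-free and attacks $Cl(\{\alpha\})$ for every $\alpha\in\mathcal{A}\setminus A$. *)

(* Defs.v *)
From mathcomp Require Import all_boot all_algebra.
From mathcomp Require Import boolp.

Set Implicit Arguments.
Unset Strict Implicit.
Unset Printing Implicit Defensive.

(** * Deterministic multitape Turing machines and the class P *)

Variant move := MoveLeft | Stay | MoveRight.

(* The tape alphabet consists of a blank, the input symbols and the work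
   symbols of the machine. *)
Definition tape_symbol (Sigma Work : finType) : finType :=
  option (Sigma + Work)%type.

(* There are [extra_tapes.+1] tapes.  [verdict q] is [Some true] on accepting
   states, [Some false] on rejecting states and [None] on all other states. *)
Record machine (Sigma : finType) := Machine {
  extra_tapes : nat;
  state : finType;
  work : finType;
  start : state;
  verdict : state -> option bool;
  transition : state -> {ffun 'I_extra_tapes.+1 -> tape_symbol Sigma work} ->
    state * {ffun 'I_extra_tapes.+1 -> tape_symbol Sigma work * move}
}.

Section Run.
Variables (Sigma : finType) (M : machine Sigma).

Local Notation Gamma := (tape_symbol Sigma (work M)).
Local Notation blank := (None : Gamma).

(* A two-way infinite tape: the cells left of the head (nearest first), the
   scanned cell, the cells right of the head (nearest first).  All cells that
   are not listed are blank. *)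
Record tape := Tape { lefts : seq Gamma; scanned : Gamma; rights : seq Gamma }.

Definition move_head (m : move) (t : tape) : tape :=
  let: Tape l c r := t in
  match m with
  | MoveLeft => Tape (behead l) (head blank l) (c :: r)
  | Stay => t
  | MoveRight => Tape (c :: l) (head blank r) (behead r)
  end.

Definition write (c : Gamma) (t : tape) : tape := Tape (lefts t) c (rights t).

Record config := Config {
  current : state M;
  tapes : {ffun 'I_(extra_tapes M).+1 -> tape}
}.

(* Halted configurations are fixed points. *)
Definition step (C : config) : config :=
  if verdict (current C) is Some _ then C else
  let: (q, act) := transition (current C) [ffun i => scanned (tapes C i)] in
  Config q [ffun i => move_head (act i).2 (write (act i).1 (tapes C i))].

Definition input_tape (w : seq Sigma) : tape :=
  let s := [seq Some (inl x) : Gamma | x <- w] in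
  Tape [::] (head blank s) (behead s).

Definition init (w : seq Sigma) : config :=
  Config (start M)
    [ffun i => if i == ord0 then input_tape w else Tape [::] blank [::]].

Definition verdict_after (n : nat) (w : seq Sigma) : option bool :=
  verdict (current (iter n step (init w))).

End Run.

Definition in_P (Sigma : finType) (lang : seq Sigma -> Prop) : Prop :=
  exists (M : machine Sigma) (p : {poly nat}),
    forall w : seq Sigma, exists b : bool,
      verdict_after M p.[size w]%R w = Some b /\ (lang w <-> b).

(** * Finite assumption-based argumentation frameworks *)

(* The list [rules] stands for the finite set of its members; a rule is the
   pair of its head and its body. *)
Record aba := ABA {
  sentence : finType;
  rules : seq (sentence * seq sentence);
  assumptions : {set sentence};
  assumptions_neq0 : assumptions != set0;
  contrary : {x : sentence | x \in assumptions} -> sentence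
}.

Definition asm (F : aba) : finType := {x : sentence F | x \in assumptions F}.

Definition bipolar (F : aba) : Prop :=
  forall r, r \in rules F ->
    exists a : asm F, r.2 = [:: val a] /\
      (r.1 \in assumptions F \/ exists b : asm F, r.1 = contrary b).

Section Semantics.
Variable F : aba.
Implicit Types (A B : {set asm F}) (R : seq (sentence F * seq (sentence F))).

(* Deduction trees with a given root label.  A rule with empty body gives a
   node whose only child is the leaf labelled top, which is left implicit. *)
Inductive deduction : sentence F -> Type :=
| Assumption (a : asm F) : deduction (val a)
| ByRule r of r \in rules F
    & (forall i : 'I_(size r.2), deduction (tnth (in_tuple r.2) i)) :
    deduction r.1.

Fixpoint leaves phi (d : deduction phi) : {set asm F} :=
  match d with
  | Assumption a => [set a]
  | ByRule r _ ch => \bigcup_(i < size r.2) leaves (ch i)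
  end.

Fixpoint rules_used phi (d : deduction phi) :
    seq (sentence F * seq (sentence F)) :=
  match d with
  | Assumption _ => [::]
  | ByRule r _ ch => r :: flatten [seq rules_used (ch i) | i : 'I_(size r.2)]
  end.

Definition deducible A R phi : Prop :=
  exists d : deduction phi, leaves d = A /\ rules_used d =i R.

Definition attacks A B : Prop :=
  exists (b : asm F) A' R,
    [/\ b \in B, deducible A' R (contrary b), A' \subset A
      & {subset R <= rules F}].

Definition Cl A : {set asm F} :=
  [set a : asm F | `[< exists A' R,
    [/\ deducible A' R (val a), A' \subset A & {subset R <= rules F}] >]].

Definition is_closed A : Prop := A = Cl A.

Definition conflict_free A : Prop := ~ attacks A A.

Definition set_stable A : Prop :=
  [/\ is_closed A, conflict_free A
    & forall a : asm F, a \notin A -> attacks A (Cl [set a])].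

End Semantics.

(** * Encoding of instances as bit strings *)

(* Self-delimiting codes.  Sentences are numbered along [enum (sentence F)] and
   written in unary; [encode] has at least one bit per sentence anyway, so this
   is polynomially equivalent to writing the numbers in binary. *)
Definition encode_nat (n : nat) : seq bool := rcons (nseq n true) false.

Definition encode_seq (T : Type) (code : T -> seq bool) (s : seq T) :
    seq bool :=
  rcons (flatten [seq true :: code x | x <- s]) false.

Section Encoding.
Variable F : aba.

Definition encode_sentence (x : sentence F) : seq bool :=
  encode_nat (enum_rank x).

Definition encode_rule (r : sentence F * seq (sentence F)) : seq bool :=
  encode_sentence r.1 ++ encode_seq encode_sentence r.2.

(* Tells whether [x] is an assumption and, if so, what its contrary is. *)
Definition encode_status (x : sentence F) : seq bool :=
  if insub x : option (asm F) is Some a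
  then true :: encode_sentence (contrary a) else [:: false].

Definition encode (A : {set asm F}) : seq bool :=
  encode_nat #|sentence F|
  ++ flatten [seq encode_status x | x : sentence F]
  ++ encode_seq encode_rule (rules F)
  ++ [seq x \in [set val a | a in A] | x : sentence F].

End Encoding.

(* Main.v *)
Require Import Defs.
From mathcomp Require Import all_boot all_algebra zify.
From HB Require Import structures.
From mathcomp Require Import boolp.

(* In a bipolar framework every deduction is a chain of one-element rules, so
   for a closed set A, with A+ the set of sentences that are in A
   or one rule away from A, the set is set-stable iff the assumptions outside A
   are exactly those from which the rules lead to some b with contrary in A+.
   This set is a least fixpoint of monotone marking steps that can all be
   performed while reading the encoding from left to right: a finite automaton
   with two work tapes, indexed by the sentences, repeats the same pass |w| + 1
   times, which is more than the length of any simple chain of rules.  Tape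
   heads only move right or are brought back to the start, so the whole run
   takes O(|w|^4) steps of a Turing machine. *)

Set Implicit Arguments.
Unset Strict Implicit.
Unset Printing Implicit Defensive.

Import GRing.Theory.

(** * Turing machines that rewind their heads *)

(** The language contains only encodings of yes-instances, so words that encode nothing must be
    rejected too: every pass also parses its input, and every accepted word is decoded back into a
    framework. One rule suffices in A+ because a chain starting in a closed set stays in the set up
    to its last assumption. Conflict-freeness needs no test of its own: for a closed set it says
    that no member leads to an assumption attacked by the set. Numbers are unary, so reading one
    moves a head onto the cell of that sentence, and a finite control can address the tapes. The
    obstacle is the fixed order statuses, rules, members: what a late segment reveals reaches an
    earlier one only in the next pass. This costs a few extra passes and means that a test may look
    only at marks that are complete or still entirely absent. The exponent 4: |w| + 1 passes of |w|
    + 1 steps make (|w| + 1)^2 automaton steps, no head gets further than that from its start, and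
    each step may be followed by a rewind over that distance. *)

Definition upd (T : Type) (f : nat -> T) (p : nat) (x : T) : nat -> T :=
  fun i => if i == p then x else f i.

Lemma updE (T : Type) (f : nat -> T) p x : upd f p x p = x.
Proof. by rewrite /upd eqxx. Qed.

Lemma upd_id (T : Type) (f : nat -> T) p : upd f p (f p) = f.
Proof. by apply/funext => i; rewrite /upd; case: eqP => [->|]. Qed.

Definition is_left (m : move) := if m is MoveLeft then true else false.

Section RewindMachine.
Variables (Sigma Work Q : finType) (k : nat).
Local Notation Gamma := (tape_symbol Sigma Work).

(* [MoveLeft] in the second component of an action is the instruction to bring
   the head back to its initial cell. *)
Variable delta : Q -> ('I_k.+1 -> Gamma) -> Q * ('I_k.+1 -> Gamma * move).
Variables (q0 : Q) (halt : Q -> option bool).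

(* The second component of a state tells which heads are being rewound; such a
   head goes left up to the first blank and then one cell to the right. *)
Definition rewind_transition (s : Q * {ffun 'I_k.+1 -> bool})
    (rd : {ffun 'I_k.+1 -> Gamma}) :
    (Q * {ffun 'I_k.+1 -> bool}) * {ffun 'I_k.+1 -> Gamma * move} :=
  if [exists i, s.2 i] then
    ((s.1, [ffun i => s.2 i && (rd i != None)]),
     [ffun i => (rd i, if s.2 i then
                         if rd i == None then MoveRight else MoveLeft
                       else Stay)])
  else
    let: (q, a) := delta s.1 rd in
    ((q, [ffun i => is_left (a i).2]), [ffun i => a i]).

Definition rewind_machine : machine Sigma :=
  @Machine Sigma k (Q * {ffun 'I_k.+1 -> bool})%type Work
    (q0, [ffun _ => false]) (fun s => halt s.1) rewind_transition.

Local Notation M := rewind_machine.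

(* Cell [0] is the blank to the left of the initial position of the head, so a
   rewound head stands on cell [1]. *)
Definition rtape := ((nat -> Gamma) * nat)%type.

Definition represents (t : tape M) (r : rtape) : Prop :=
  [/\ scanned t = r.1 r.2,
      forall j, nth None (lefts t) j = if j < r.2 then r.1 (r.2 - j.+1) else None
    & forall j, nth None (rights t) j = r.1 (r.2 + j.+1)].

Lemma represents_write t f p c :
  represents t (f, p) -> represents (write (M := M) c t) (upd f p c, p).
Proof.
case: t => l c0 r [/= _ Hl Hr]; split=> [|j|j] /=; first by rewrite updE.
- by rewrite Hl /upd; case: ltnP => // jp; rewrite ifN //; lia.
- by rewrite Hr /upd ifN //; lia.
Qed.

Lemma represents_right t f p :
  represents t (f, p) -> represents (move_head MoveRight t) (f, p.+1).
Proof.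
case: t => l c r [/= Hc Hl Hr]; split=> [|j|j] /=.
- by rewrite -nth0 Hr addn1.
- case: j => [|j] /=; first by rewrite Hc subn1.
  by rewrite Hl ltnS subSS.
- by rewrite nth_behead Hr addSnnS.
Qed.

Lemma represents_left t f p :
  represents t (f, p.+1) -> represents (move_head MoveLeft t) (f, p).
Proof.
case: t => l c r [/= Hc Hl Hr]; split=> [|j|j] /=.
- by rewrite -nth0 Hl /= subn1.
- by rewrite nth_behead Hl ltnS subSS.
- case: j => [|j] /=; first by rewrite Hc addn1.
  by rewrite Hr addSnnS.
Qed.

Definition act (r : rtape) (a : Gamma * move) : rtape :=
  (upd r.1 r.2 a.1,
   match a.2 with MoveLeft => 1 | Stay => r.2 | MoveRight => r.2.+1 end).

Definition rconfig := (Q * ('I_k.+1 -> rtape))%type.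

Definition rstep (c : rconfig) : rconfig :=
  let: (q, a) := delta c.1 (fun i => (c.2 i).1 (c.2 i).2) in
  (q, fun i => act (c.2 i) (a i)).

(** A rewinding head meets no blank before cell [0]. The scanned cell itself may be blank, since a
    rewind begins by moving left off it. The hypothesis [delta_right] keeps this invariant. *)
Definition rtape_ok (r : rtape) : Prop :=
  [/\ r.1 0 = None, 0 < r.2 & forall j, 0 < j < r.2 -> r.1 j != None].

Hypothesis delta_right : forall q rd i,
  ((delta q rd).2 i).2 = MoveRight -> ((delta q rd).2 i).1 != None.

Definition simulates (C : config M) (c : rconfig) : Prop :=
  current C = (c.1, [ffun _ => false])
  /\ forall i, represents (tapes C i) (c.2 i) /\ rtape_ok (c.2 i).

Lemma rewind_step (C : config M) (q : Q) (g : {ffun 'I_k.+1 -> bool})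
    (r : 'I_k.+1 -> rtape) :
  halt q = None -> current C = (q, g) -> [exists i, g i] ->
  (forall i, represents (tapes C i) (r i)) ->
  (forall i, g i -> (r i).1 0 = None
                 /\ forall j, 0 < j <= (r i).2 -> (r i).1 j != None) ->
  current (step C) = (q, [ffun i => g i && ((r i).2 != 0)])
  /\ forall i, represents (tapes (step C) i)
       ((r i).1, if g i then if (r i).2 == 0 then 1 else (r i).2.-1
                 else (r i).2).
Proof.
move=> hq Cq gT Cr Hg.
have z i : g i -> ((r i).1 (r i).2 == None) = ((r i).2 == 0).
  move=> gi; have [f0 Hf] := Hg i gi.
  case: posnP => [->|p0]; first by rewrite f0.
  by apply: negbTE; apply: Hf; rewrite p0 leqnn.
rewrite /step Cq /= hq /rewind_transition /= gT; split=> [|i] /=.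
  congr pair; apply/ffunP => i; rewrite !ffunE.
  by have [-> _ _] := Cr i; case gi : (g i) => //=; rewrite z.
rewrite !ffunE; have [Ei _ _] := Cr i; move: (Cr i) (z i); rewrite Ei.
case: (r i) => f p /= /(represents_write (f p)); rewrite upd_id => Ri.
case: (g i) => // -> //; case: p Ri {Ei} => [|p] /=.
  exact: represents_right.
exact: represents_left.
Qed.

(** A head on cell p needs p steps to reach the boundary blank and one more to step onto cell [1],
    hence the strict bound by [b]. Flagged heads travel in parallel; those already back wait. *)
Lemma rewind_run b (C : config M) (q : Q) (g : {ffun 'I_k.+1 -> bool})
    (r : 'I_k.+1 -> rtape) :
  halt q = None -> current C = (q, g) ->
  (forall i, represents (tapes C i) (r i)) ->
  (forall i, g i -> [/\ (r i).2 < b, (r i).1 0 = None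
                      & forall j, 0 < j <= (r i).2 -> (r i).1 j != None]) ->
  exists2 n, n <= b &
    current (iter n (@step _ M) C) = (q, [ffun _ => false]) /\
    forall i, represents (tapes (iter n (@step _ M) C) i)
                ((r i).1, if g i then 1 else (r i).2).
Proof.
move=> hq; elim: b C g r => [|b IH] C g r Cq Cr Hg;
  have [gT|gF] := boolP [exists i, g i].
2,4: exists 0 => //; have {}gF i : g i = false
  by apply: contraNF gF => gi; apply/existsP; exists i.
2,3: split=> [|i]; last by rewrite gF -surjective_pairing; apply: Cr.
2,3: by rewrite Cq; congr pair; apply/ffunP => i; rewrite ffunE gF.
  by case/existsP: gT => i /Hg [].
have Hg' i : g i -> (r i).1 0 = None
    /\ forall j, 0 < j <= (r i).2 -> (r i).1 j != None by case/Hg.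
have [Eq Er] := rewind_step hq Cq gT Cr Hg'.
have [|n nb [E1 E2]] := IH _ _ _ Eq Er.
  move=> i; rewrite ffunE => /andP[gi p0]; rewrite gi (negbTE p0) /=.
  have [] := Hg i gi; case: (r i) p0 => f [|p] //= _ pb f0 Hf.
  by split=> // j /andP[j0 jp]; apply: Hf; rewrite j0 leqW.
exists n.+1 => //; rewrite iterSr; split=> // i.
have := E2 i; rewrite ffunE /=; case: (g i) => //=.
by case: eqP.
Qed.

(** One step performs the action and at most [b] more bring heads back. The new state must not be
    halting, because a halted configuration is frozen before its heads are rewound. *)
Lemma simulate_step b (C : config M) (c : rconfig) :
  simulates C c -> halt c.1 = None -> halt (rstep c).1 = None ->
  (forall i, (c.2 i).2 < b) ->
  exists2 n, n <= b.+1 & simulates (iter n (@step _ M) C) (rstep c).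
Proof.
case: c => q r [/= Cq Cr] /= hq hq' rb.
move: hq'; rewrite /rstep /=; set rd := fun i => (r i).1 (r i).2.
case E : (delta q rd) => [q' a] /= hq'.
have E0 : step C = Config (M := M) (q', [ffun i => is_left (a i).2])
    [ffun i => move_head (a i).2 (write (M := M) (a i).1 (tapes C i))].
  rewrite /step Cq /= hq /rewind_transition /=.
  rewrite ifN; last by apply/existsPn => i; rewrite ffunE.
  have -> : ([ffun i => scanned (tapes C i)] : _ -> _) = rd.
    by apply/funext => i; rewrite ffunE; case: (Cr i) => -[].
  by rewrite E; congr Config; apply/ffunP => i; rewrite !ffunE.
have [|i|n nb [E1 E2]] := @rewind_run b (step C) q' [ffun i => is_left (a i).2]
  (fun i => (upd (r i).1 (r i).2 (a i).1,
    match (a i).2 with MoveLeft => (r i).2.-1 | Stay => (r i).2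
                     | MoveRight => (r i).2.+1 end)) hq' (congr1 (@current _ M) E0).
- move=> i; have [Ri [_ p0 _]] := Cr i.
  have -> : tapes (step C) i =
    move_head (a i).2 (write (M := M) (a i).1 (tapes C i)).
    by rewrite E0 /= ffunE.
  case: (r i) Ri p0 => f p Ri /= p0.
  have Wi := represents_write (a i).1 Ri.
  case: (a i).2; [|exact: Wi|exact: (represents_right Wi)].
  by case: p p0 Ri Wi => // p _ _; apply: represents_left.
- rewrite ffunE; case Ea : (a i).2 => //= _.
  case: (r i) (Cr i) (rb i) => f p [_ [/= f0 p0 Hf]] pb; split.
  + lia.
  + by rewrite /upd ifN //; lia.
  + move=> j /andP[j0 jp]; rewrite /upd ifN; last lia.
    by apply: Hf; lia.
exists n.+1 => //; rewrite iterSr; split=> //= i.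
split; first by have := E2 i; rewrite ffunE /act /=; case: (a i).2.
have := @delta_right q rd i; rewrite E /= => da.
case: (r i) (Cr i) => f p [_ [/= f0 p0 Hf]]; split=> /=.
- by rewrite /upd ifN //; lia.
- by case: (a i).2.
- move=> j /andP[j0 jp]; rewrite /upd; case: (j =P p) => [jE|jN].
    have Ea : (a i).2 = MoveRight by move: jp; rewrite jE; case: (a i).2 => //; lia.
    exact: da.
  by apply: Hf; move: jp; case: (a i).2 => //; lia.
Qed.

Lemma simulate_iter b (C : config M) (c : rconfig) m :
  simulates C c ->
  (forall j, j <= m -> halt (iter j rstep c).1 = None
                    /\ forall i, ((iter j rstep c).2 i).2 < b) ->
  exists2 n, n <= m * b.+1 & simulates (iter n (@step _ M) C) (iter m rstep c).
Proof.
move=> S0; elim: m => [|m IH] H; first by exists 0.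
have [|n nm Sn] := IH; first by move=> j jm; apply: H; lia.
have [h1 h2] := H m (leqnSn m); have [h3 _] := H m.+1 (leqnn _).
have [n' nb Sn'] := simulate_step Sn h1 h3 h2.
by exists (n' + n); [rewrite mulSn leq_add|rewrite iterD].
Qed.

Definition blank_rtape : rtape := (fun _ => None, 1).

Definition word_rtape (w : seq Sigma) : rtape :=
  (fun j => if j is j'.+1 then nth None [seq Some (inl x) : Gamma | x <- w] j'
            else None, 1).

(** Serves for the last step, after which the machine is frozen and only the state has to agree. *)
Lemma simulate_current (C : config M) (c : rconfig) :
  simulates C c -> halt c.1 = None ->
  (current (step C)).1 = (rstep c).1.
Proof.
case: c => q r [/= Cq Cr] hq; rewrite /rstep /step Cq /= hq.
rewrite /rewind_transition /= ifN; last by apply/existsPn => i; rewrite ffunE.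
have -> : ([ffun i => scanned (tapes C i)] : _ -> _)
          = fun i => (r i).1 (r i).2.
  by apply/funext => i; rewrite ffunE; case: (Cr i) => -[].
by case: (delta _ _).
Qed.

Definition rinit (w : seq Sigma) : rconfig :=
  (q0, fun i => if i == ord0 then word_rtape w else blank_rtape).

Lemma simulate_init w : simulates (init M w) (rinit w).
Proof.
split=> //= i; rewrite ffunE; case: eqP => _; split; try by split=> // -[].
  split=> [|j|j] /=; first by rewrite -nth0.
    by rewrite nth_nil; case: j.
  by rewrite nth_behead.
Qed.

Lemma iter_step_halted (C : config M) m n b :
  m <= n -> verdict (current (iter m (@step _ M) C)) = Some b ->
  verdict (current (iter n (@step _ M) C)) = Some b.
Proof.
move=> /subnK <-; elim: (n - m) => [//|d IH] /IH {}IH.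
by rewrite addSn iterS {1}/step; move: (IH); case: (verdict _) => //= b' ->.
Qed.

(** A step takes a head at most one cell to the right, so during [m] steps all heads stay below cell
    [m.+2]; these steps cost at most [m * (m + 3)], and one more halts. *)
Lemma rewind_machine_verdict w m b n :
  (forall j, j <= m -> halt (iter j rstep (rinit w)).1 = None) ->
  halt (iter m.+1 rstep (rinit w)).1 = Some b ->
  (m.+1) * (m + 3) <= n ->
  verdict_after M n w = Some b.
Proof.
move=> Hm hb mn.
have pos j i : ((iter j rstep (rinit w)).2 i).2 <= j.+1.
  elim: j => [|j IH] /=; first by case: eqP.
  rewrite {1}/rstep; case: (delta _ _) => q a /=.
  by case: (a i).2 => //=; rewrite ?ltnS // leqW.
have [j jm|nn nm Sn] := @simulate_iter m.+2 _ _ m (simulate_init w).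
  by split=> [|i]; [apply: Hm|apply: leq_ltn_trans (pos j i) _; lia].
have := simulate_current Sn (Hm m (leqnn _)); rewrite -!iterS => hc.
by apply: (@iter_step_halted _ nn.+1); [lia|rewrite /= -iterS hc].
Qed.
End RewindMachine.

(** * Repeated passes over the input *)

Section Passes.
Variables (Q S : finType) (s0 : S) (q0 : Q).
Variable scan : Q -> bool -> S -> S -> Q * (S * move) * (S * move).
Variables (restart : Q -> S -> S -> Q) (accept : Q -> S -> S -> bool).

Definition wtape := ((nat -> S) * nat)%type.
Definition store := (Q * wtape * wtape)%type.

Definition wact (t : wtape) (a : S * move) : wtape :=
  (upd t.1 t.2 a.1,
   match a.2 with MoveLeft => 0 | Stay => t.2 | MoveRight => t.2.+1 end).

Definition scan_bit (s : store) (b : bool) : store :=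
  let: (q, x, y) := s in
  let: (q', ax, ay) := scan q b (x.1 x.2) (y.1 y.2) in
  (q', wact x ax, wact y ay).

Definition close_pass (s : store) : store :=
  let: (q, x, y) := s in (restart q (x.1 x.2) (y.1 y.2), (x.1, 0), (y.1, 0)).

Definition pass (w : seq bool) (s : store) : store :=
  close_pass (foldl scan_bit s w).

Definition store0 : store := (q0, (fun _ => s0, 0), (fun _ => s0, 0)).

Definition accepting (s : store) : bool :=
  let: (q, x, y) := s in accept q (x.1 x.2) (y.1 y.2).

Definition multipass_accepts (w : seq bool) : bool :=
  accepting (foldl scan_bit (iter (size w) (pass w) store0) w).

Local Notation Work := (bool + S)%type.
Local Notation Gamma := (tape_symbol bool Work).
Local Notation state := ((Q * bool) + bool)%type.

Let i1 : 'I_3 := Ordinal (isT : 1 < 3).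
Let i2 : 'I_3 := Ordinal (isT : 2 < 3).

Definition pick3 (T : Type) (a b c : T) (i : 'I_3) : T :=
  match val i with 0 => a | 1 => b | _ => c end.

Definition symbol_of (g : Gamma) : S := if g is Some (inr (inr s)) then s else s0.

Definition bit_of (g : bool + Work) : bool :=
  match g with inl b => b | inr (inl b) => b | _ => false end.

Definition unmarked (g : bool + Work) : bool := if g is inl _ then true else false.

(* Each pass turns the first input bit [inl b] into the marked bit
   [inr (inl b)], and the boolean in the state tells whether the current pass
   has done so; a pass that finds no bit to mark is the last one. *)
Definition pass_delta (q : state) (rd : 'I_3 -> Gamma) :
    state * ('I_3 -> Gamma * move) :=
  match q with
  | inr _ => (q, fun i => (rd i, Stay))
  | inl (u, flag) =>
    let sx := symbol_of (rd i1) in let sy := symbol_of (rd i2) in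
    match rd ord0 with
    | None => if flag
              then (inl (restart u sx sy, false), fun i => (rd i, MoveLeft))
              else (inr (accept u sx sy), fun i => (rd i, Stay))
    | Some g =>
      let: (u', ax, ay) := scan u (bit_of g) sx sy in
      (inl (u', flag || unmarked g),
       pick3 (Some (if unmarked g && ~~ flag then inr (inl (bit_of g)) else g),
              MoveRight)
             (Some (inr (inr ax.1)), ax.2) (Some (inr (inr ay.1)), ay.2))
    end
  end.

Definition pass_halt (q : state) : option bool :=
  if q is inr b then Some b else None.

Local Notation rstep := (@rstep _ _ _ 2 pass_delta).
Local Notation rconfig := (rconfig bool Work state 2).

Lemma pass_delta_right q rd i :
  ((pass_delta q rd).2 i).2 = MoveRight -> ((pass_delta q rd).2 i).1 != None.
Proof.
case: q => [[u flag]|b] //=; case: (rd ord0) => [g|]; last by case: flag.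
by case: (scan _ _ _ _) => [[u' ax] ay]; rewrite /pick3; case: i => [[|[|[|]]]].
Qed.

Definition marked_word (w : seq bool) (c : nat) : nat -> Gamma := fun j =>
  if j is j'.+1 then
    if j' < size w then
      let b := nth false w j' in Some (if j' < c then inr (inl b) else inl b)
    else None
  else None.

(** Indices shift by one because of the boundary blank in cell [0]; a blank cell stands for [s0]. *)
Definition holds (r : rtape bool Work) (t : wtape) : Prop :=
  r.2 = t.2.+1 /\ forall j, symbol_of (r.1 j.+1) = t.1 j.

(** After [t] closed passes [t] bits are marked; the current pass marks bit number [t] when reading
    it, which has happened iff [t < i]. *)
Definition in_pass (w : seq bool) (t i : nat) (c : rconfig) (s : store) : Prop :=
  [/\ c.1 = inl (s.1.1, t < i), c.2 ord0 = (marked_word w (t + (t < i)), i.+1),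
      holds (c.2 i1) s.1.2 & holds (c.2 i2) s.2].

Lemma holds_act r t a :
  holds r t -> holds (act r (Some (inr (inr a.1)), a.2)) (wact t a).
Proof.
case: r t => f p [g p'] [/= -> H]; split=> [|j] /=; first by case: a.2.
by rewrite /upd eqSS; case: eqP.
Qed.

Lemma in_pass_scan w t i c s : i < size w -> in_pass w t i c s ->
  in_pass w t i.+1 (rstep c) (scan_bit s (nth false w i)).
Proof.
case: c s => q r [[u x] y] iw [/= -> E0 [E1 X] [E2 Y]].
have Ex : symbol_of ((r i1).1 (r i1).2) = x.1 x.2 by rewrite E1.
have Ey : symbol_of ((r i2).1 (r i2).2) = y.1 y.2 by rewrite E2.
rewrite /rstep /= Ex Ey E0 /= iw.
have -> : bit_of (if i < t + (t < i) then inr (inl (nth false w i))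
                  else inl (nth false w i)) = nth false w i by case: ifP.
case: (scan _ _ _ _) => [[u' ax] ay] /=; split=> /=.
- by congr (inl (_, _)); case: ifP => /=; lia.
- rewrite E0 /act /=; congr pair; apply/funext => j; rewrite /upd.
  case: eqP => [->|ne] /=; last first.
    case: j ne => // j ne /=; case: ifP => // _.
    by congr (Some (if _ then _ else _)); lia.
  by rewrite iw; do ![case: ifP => /=] => // *; lia.
- by apply: holds_act.
- by apply: holds_act.
Qed.

Lemma in_pass_close w t c s : t < size w -> in_pass w t (size w) c s ->
  in_pass w t.+1 0 (rstep c) (close_pass s).
Proof.
case: c s => q r [[u x] y] tw [/= -> E0 [E1 X] [E2 Y]].
have Ex : symbol_of ((r i1).1 (r i1).2) = x.1 x.2 by rewrite E1.
have Ey : symbol_of ((r i2).1 (r i2).2) = y.1 y.2 by rewrite E2.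
rewrite /rstep /= Ex Ey E0 /= ltnn tw; split=> //=.
- rewrite E0 /act /= tw ltnn addn0 addn1; congr pair; apply/funext => j.
  by rewrite /upd; case: eqP => [->|] //=; rewrite ltnn.
- by split=> // j; rewrite /act /= upd_id X.
- by split=> // j; rewrite /act /= upd_id Y.
Qed.

Lemma in_pass_halt w c s : in_pass w (size w) (size w) c s ->
  (rstep c).1 = inr (accepting s).
Proof.
case: c s => q r [[u x] y] [/= -> E0 [E1 X] [E2 Y]].
have Ex : symbol_of ((r i1).1 (r i1).2) = x.1 x.2 by rewrite E1.
have Ey : symbol_of ((r i2).1 (r i2).2) = y.1 y.2 by rewrite E2.
by rewrite /rstep /= Ex Ey E0 /= ltnn.
Qed.

Local Notation pass_init w := (@rinit bool Work state 2 (inl (q0, false)) w).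

(** A closed pass takes [size w] reading steps and one step on the blank behind the input, which
    sends all heads back. *)
Lemma in_pass_iter w t i : t <= size w -> i <= size w ->
  in_pass w t i (iter (t * (size w).+1 + i) rstep (pass_init w))
    (foldl scan_bit (iter t (pass w) store0) (take i w)).
Proof.
elim: t i => [|t IHt] i tw; elim: i => [|i IHi] iw.
- rewrite take0; split=> //=; congr pair; apply/funext => -[|j] //=.
  case: ltnP => jw; first by rewrite (nth_map false).
  by rewrite nth_default // size_map.
- rewrite addnS iterS (take_nth false) // foldl_rcons.
  by apply: in_pass_scan => //; apply: IHi; lia.
- have -> : t.+1 * (size w).+1 + 0 = (t * (size w).+1 + size w).+1 by lia.
  rewrite take0 /=.
  by have := IHt (size w); rewrite take_size => H; apply: in_pass_close; auto.
- rewrite addnS iterS (take_nth false) // foldl_rcons.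
  by apply: in_pass_scan => //; apply: IHi; lia.
Qed.

Lemma in_P_multipass : in_P multipass_accepts.
Proof.
exists (rewind_machine pass_delta (inl (q0, false)) pass_halt).
(* With N = [size w] and m = N * N.+1 + N the run halts at step m.+1, which is (N + 1)^2; the
   polynomial is m.+1 * (m + 3). *)
exists (('X + 1) ^+ 2 * (('X + 1) ^+ 2 + 2%:R))%R => w.
exists (multipass_accepts w); split=> //.
set N := size w.
have last := in_pass_iter (leqnn N) (leqnn N).
apply: (@rewind_machine_verdict _ _ _ _ _ _ _ pass_delta_right w
          (N * N.+1 + N)).
- move=> j jm; have jN : j %/ N.+1 <= N.
    by rewrite -ltnS ltn_divLR //; lia.
  have := @in_pass_iter w (j %/ N.+1) (j %% N.+1) jN.
  rewrite -divn_eq -ltnS ltn_mod => /(_ isT) [-> _ _ _].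
  by [].
- by move: last; rewrite take_size => /in_pass_halt /= ->.
- rewrite hornerM hornerD !expr2 !hornerM !hornerD hornerX hornerC.
  rewrite -[leqRHS]/((N + 1) * (N + 1) * ((N + 1) * (N + 1) + 2)).
  have -> : (N + 1) * (N + 1) = (N * N.+1 + N).+1 by lia.
  by rewrite leq_mul2l addnS addSn addn2 leqnn orbT.
Qed.
End Passes.

(** * The automaton *)

Lemma upd_upd (T : Type) (f : nat -> T) p x y : upd (upd f p x) p y = upd f p y.
Proof. by apply/funext => i; rewrite /upd; case: eqP. Qed.

(* Cell [i] of either tape holds four marks of sentence [i]: "is a sentence",
   then on the first tape "is a contrary", "is in the set or one-step derivable
   from it", unused; on the second tape "is an assumption", "is in the set",
   "derives an assumption attacked by the set". *)
Definition cell := (bool * bool * bool * bool)%type.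
Definition mark1 (c : cell) := c.1.1.1.
Definition mark2 (c : cell) := c.1.1.2.
Definition mark3 (c : cell) := c.1.2.
Definition mark4 (c : cell) := c.2.

Definition join (c d : cell) : cell :=
  (mark1 c || mark1 d, mark2 c || mark2 d, mark3 c || mark3 d, mark4 c || mark4 d).

(** [Status] remembers whether an assumption has been seen; [Body] and [BodyNum] carry the
    second-tape marks of the rule head (assumption, member, defeated) to the cell of the body;
    [Members] keeps the verdict so far. *)
Variant phase :=
  | Count
  | Status of bool
  | Contrary
  | Rules
  | Head
  | Body of bool & bool & bool
  | BodyNum of bool & bool & bool
  | BodyEnd
  | Members of bool
  | Dead.

Definition phase_code (q : phase) : 'I_10 * (bool * bool * bool) :=
  match q with
  | Count => (inord 0, (false, false, false))
  | Status a => (inord 1, (a, false, false))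
  | Contrary => (inord 2, (false, false, false))
  | Rules => (inord 3, (false, false, false))
  | Head => (inord 4, (false, false, false))
  | Body a b c => (inord 5, (a, b, c))
  | BodyNum a b c => (inord 6, (a, b, c))
  | BodyEnd => (inord 7, (false, false, false))
  | Members a => (inord 8, (a, false, false))
  | Dead => (inord 9, (false, false, false))
  end.

Definition phase_decode (p : 'I_10 * (bool * bool * bool)) : phase :=
  let: (i, (a, b, c)) := p in
  match val i with
  | 0 => Count | 1 => Status a | 2 => Contrary | 3 => Rules | 4 => Head
  | 5 => Body a b c | 6 => BodyNum a b c | 7 => BodyEnd | 8 => Members a
  | _ => Dead
  end.

Lemma phase_codeK : cancel phase_code phase_decode.
Proof. by case=> *; rewrite /= inordK. Qed.

HB.instance Definition _ := Finite.copy phase (can_type phase_codeK).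

(** The statuses have no end mark: their end shows when the second head reaches a cell without
    [mark1], and the bit just read then already belongs to the rule list. While a rule is read, the
    first head waits on the cell of the rule head and the second one goes back and on to the body.
    There the closedness test is made, membership in A+ is passed from body to head, and defeat from
    head to body. *)
Definition scan (q : phase) (b : bool) (x y : cell) :
    phase * (cell * move) * (cell * move) :=
  let dead := (Dead, (x, Stay), (y, Stay)) in
  match q with
  | Count =>
    if b then (Count, (join x (true, false, false, false), MoveRight),
                      (join y (true, false, false, false), MoveRight))
    else (Status false, (x, MoveLeft), (y, MoveLeft))
  | Status ne =>
    if mark1 y then
      if b then (Contrary, (x, Stay), (join y (false, true, false, false), Stay))
      else (Status ne, (x, Stay), (y, MoveRight))
    else if ne then
      ((if b then Head else Members true), (x, MoveLeft), (y, MoveLeft))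
    else dead
  | Contrary =>
    if b then (Contrary, (x, MoveRight), (y, Stay))
    else if mark1 x then
      (Status true, (join x (false, true, false, false), MoveLeft),
                    (join y (false, false, false, mark3 x), MoveRight))
    else dead
  | Rules => ((if b then Head else Members true), (x, Stay), (y, Stay))
  | Head =>
    if b then (Head, (x, MoveRight), (y, MoveRight))
    else if mark2 y || mark2 x then
      (Body (mark2 y) (mark3 y) (mark4 y), (x, Stay), (y, MoveLeft))
    else dead
  | Body s a g => if b then (BodyNum s a g, (x, Stay), (y, Stay)) else dead
  | BodyNum s a g =>
    if b then (BodyNum s a g, (x, Stay), (y, MoveRight))
    else if mark2 y && (mark3 y && s ==> a) then
      (BodyEnd, (join x (false, false, mark3 y, false), MoveLeft),
                (join y (false, false, false, g), MoveLeft))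
    else dead
  | BodyEnd => if b then dead else (Rules, (x, Stay), (y, Stay))
  | Members good =>
    if mark1 y && (b ==> mark2 y) then
      (Members (good && (mark2 y ==> b (+) mark4 y)),
       (join x (false, false, b, false), MoveRight),
       (join y (false, false, b, false), MoveRight))
    else dead
  | Dead => dead
  end.

Definition restart (q : phase) (x y : cell) : phase :=
  if q is Members _ then if mark1 y then Dead else Count else Dead.

Definition accept (q : phase) (x y : cell) : bool :=
  if q is Members good then good && ~~ mark1 y else false.

(** * Effect of each segment of the encoding on the two tapes *)

Local Notation cells := (nat -> cell).
Local Notation automaton_store := (store phase cell).

Definition alive (s : automaton_store) : bool := if s.1.1 is Dead then false else true.

(** [Dead] is absorbing, so dead stores can be collapsed to [None]; each segment of the input then
    acts as a partial function on the tapes, and segments compose by [obind]. *)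
Definition run (w : seq bool) (s : automaton_store) : option automaton_store :=
  let s' := foldl (scan_bit scan) s w in if alive s' then Some s' else None.

Lemma dead_run w s : ~~ alive s -> run w s = None.
Proof.
rewrite /run; elim: w s => [|b w IH] [[q x] y]; first by case: q.
by case: q => // _; apply: IH.
Qed.

Lemma run_cat u v s : run (u ++ v) s = obind (run v) (run u s).
Proof.
rewrite [run u s]/run; case: ifP => [_|/negbT/(dead_run v)];
by rewrite /run foldl_cat.
Qed.

Lemma run_cons b w s : run (b :: w) s = run w (scan_bit scan s b).
Proof. by []. Qed.

Lemma encode_natE n u : encode_nat n ++ u = nseq n true ++ false :: u.
Proof. by rewrite /encode_nat cat_rcons. Qed.

Definition code_status (o : option nat) : seq bool :=
  if o is Some c then true :: encode_nat c else [:: false].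

Definition code_rule (r : nat * nat) : seq bool :=
  encode_nat r.1 ++ encode_seq encode_nat [:: r.2].

Definition code (n : nat) (sts : seq (option nat)) (rls : seq (nat * nat))
    (mem : seq bool) : seq bool :=
  encode_nat n ++ flatten (map code_status sts) ++ encode_seq code_rule rls ++ mem.

Definition count_cells (n : nat) (X : cells) : cells := fun k =>
  if k < n then join (X k) (true, false, false, false) else X k.

Lemma run_count n u X Y :
  run (encode_nat n ++ u) (Count, (X, 0), (Y, 0)) =
  run u (Status false, (count_cells n X, 0), (count_cells n Y, 0)).
Proof.
rewrite encode_natE.
suff H m i X' Y' : run (nseq m true ++ false :: u) (Count, (X', i), (Y', i)) =
  run u (Status false,
   (fun k => if i <= k < i + m then join (X' k) (true, false, false, false)
             else X' k, 0),
   (fun k => if i <= k < i + m then join (Y' k) (true, false, false, false)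
             else Y' k, 0)).
  by rewrite H.
elim: m i X' Y' => [|m IH] i X' Y'; rewrite run_cons /=.
  rewrite /wact /= !upd_id; congr (run _ (_, (_, _), (_, _))); apply/funext => k;
  by rewrite ifN //; lia.
rewrite /wact /= IH; congr (run _ (_, (_, _), (_, _))); apply/funext => k;
by rewrite /upd; case: (k =P i) => [->|ki]; do !case: ifP => //; lia.
Qed.

Lemma run_contrary c u X i T :
  run (nseq c true ++ u) (Contrary, (X, i), T) = run u (Contrary, (X, i + c), T).
Proof.
elim: c i => [|c IH] i; first by rewrite addn0.
case: T IH => Y j IH; rewrite run_cons /= /wact /= !upd_id.
by rewrite (IH i.+1) addSnnS.
Qed.

Definition do_status (i : nat) (o : option nat) (XY : cells * cells) :
    option (cells * cells) :=
  if o is Some c then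
    if mark1 (XY.1 c) then
      Some (upd XY.1 c (join (XY.1 c) (false, true, false, false)),
            upd XY.2 i (join (XY.2 i) (false, true, false, mark3 (XY.1 c))))
    else None
  else Some XY.

Lemma joinA : associative join.
Proof. by move=> x y z; rewrite /join /mark1 /mark2 /mark3 /mark4 /= !orbA. Qed.

Lemma run_status ne i o u X Y : mark1 (Y i) ->
  run (code_status o ++ u) (Status ne, (X, 0), (Y, i)) =
  obind (fun XY => run u (Status (ne || isSome o), (XY.1, 0), (XY.2, i.+1)))
    (do_status i o (X, Y)).
Proof.
case: o => [c|] Yi /=; rewrite run_cons /= Yi /wact /= ?upd_id ?orbF // orbT.
rewrite encode_natE run_contrary run_cons /= /wact /= add0n.
case: ifP => [_|]; last by move=> _; rewrite dead_run.
by rewrite /= updE upd_upd -joinA.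
Qed.

Fixpoint do_statuses (i : nat) (l : seq (option nat)) (XY : cells * cells) :=
  if l is o :: l' then obind (do_statuses i.+1 l') (do_status i o XY)
  else Some XY.

Lemma mark1_upd (X : cells) c d k :
  mark1 d = false -> mark1 (upd X c (join (X c) d) k) = mark1 (X k).
Proof.
by rewrite /upd => E; case: eqP => [->|//]; rewrite /join /mark1 /= [d.1.1.1]E orbF.
Qed.

Lemma do_status_range i o XY XY' : do_status i o XY = Some XY' ->
  forall k, mark1 (XY'.1 k) = mark1 (XY.1 k) /\ mark1 (XY'.2 k) = mark1 (XY.2 k).
Proof.
case: o => [c|] /=; last by case=> ->.
by case: ifP => // _ [<-] k; rewrite !mark1_upd.
Qed.

Lemma run_statuses ne i l u X Y : (forall j, j < size l -> mark1 (Y (i + j))) ->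
  run (flatten (map code_status l) ++ u) (Status ne, (X, 0), (Y, i)) =
  obind (fun XY => run u (Status (ne || has isSome l), (XY.1, 0), (XY.2, i + size l)))
    (do_statuses i l (X, Y)).
Proof.
elim: l ne i X Y => [|o l IH] ne i X Y H /=; first by rewrite orbF addn0.
rewrite -catA run_status; last by have := H 0 isT; rewrite addn0.
case E : (do_status _ _ _) => [[X' Y']|] //=.
rewrite IH; first by rewrite orbA addSnnS.
by move=> j jl; have [_ ->] := do_status_range E (i.+1 + j); rewrite addSnnS H.
Qed.

Lemma run_status_end b u X Y i : mark1 (Y i) = false ->
  run (b :: u) (Status true, (X, 0), (Y, i)) = run (b :: u) (Rules, (X, 0), (Y, 0)).
Proof. by move=> Yi; rewrite !run_cons /= Yi /wact /= !upd_id. Qed.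

Lemma run_status_empty b u X Y i : mark1 (Y i) = false ->
  run (b :: u) (Status false, (X, 0), (Y, i)) = None.
Proof. by move=> Yi; rewrite run_cons /= Yi dead_run. Qed.

Lemma run_head h u X Y i j :
  run (nseq h true ++ u) (Head, (X, i), (Y, j)) = run u (Head, (X, i + h), (Y, j + h)).
Proof.
elim: h i j => [|h IH] i j; first by rewrite !addn0.
by rewrite run_cons /= /wact /= !upd_id IH !addSnnS.
Qed.

Lemma run_body a u s m g T Y i :
  run (nseq a true ++ u) (BodyNum s m g, T, (Y, i)) =
  run u (BodyNum s m g, T, (Y, i + a)).
Proof.
elim: a i => [|a IH] i; first by rewrite addn0.
case: T IH => X j IH; rewrite run_cons /= /wact /= !upd_id.
by rewrite IH addSnnS.
Qed.

Definition do_rule (XY : cells * cells) (r : nat * nat) :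
    option (cells * cells) :=
  let: (h, a) := r in let: (X, Y) := XY in
  if [&& mark2 (Y h) || mark2 (X h), mark2 (Y a)
       & mark3 (Y a) && mark2 (Y h) ==> mark3 (Y h)] then
    Some (upd X h (join (X h) (false, false, mark3 (Y a), false)),
          upd Y a (join (Y a) (false, false, false, mark4 (Y h))))
  else None.

Lemma run_rule r u X Y :
  run (true :: code_rule r ++ u) (Rules, (X, 0), (Y, 0)) =
  obind (fun XY => run u (Rules, (XY.1, 0), (XY.2, 0))) (do_rule (X, Y) r).
Proof.
case: r => h a; rewrite /code_rule -catA encode_natE run_cons /= /wact /= !upd_id.
rewrite run_head !add0n run_cons /=; case: (_ || _); last by rewrite dead_run.
rewrite /wact /= !upd_id run_cons /= /wact /= !upd_id cats0 cat_rcons.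
rewrite encode_natE run_body add0n run_cons /=.
case: (_ && _); last by rewrite dead_run.
by rewrite /wact /= run_cons /= /wact /= !upd_id.
Qed.

Fixpoint do_rules (l : seq (nat * nat)) (XY : cells * cells) :=
  if l is r :: l' then obind (do_rules l') (do_rule XY r) else Some XY.

Lemma encode_seq_cons (T : Type) (f : T -> seq bool) x s :
  encode_seq f (x :: s) = true :: f x ++ encode_seq f s.
Proof. by rewrite /encode_seq /= -rcons_cat. Qed.

Lemma run_rules l u X Y :
  run (encode_seq code_rule l ++ u) (Rules, (X, 0), (Y, 0)) =
  obind (fun XY => run u (Members true, (XY.1, 0), (XY.2, 0))) (do_rules l (X, Y)).
Proof.
elim: l X Y => [|r l IH] X Y.
  by rewrite run_cons /= /wact /= !upd_id.
rewrite encode_seq_cons cat_cons -catA run_rule /=.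
by case: (do_rule _ _) => [[X' Y']|] //=.
Qed.

Fixpoint do_members (i : nat) (l : seq bool) (good : bool) (XY : cells * cells) :
    option (bool * (cells * cells)) :=
  if l is b :: l' then
    let: (X, Y) := XY in
    if mark1 (Y i) && (b ==> mark2 (Y i)) then
      do_members i.+1 l' (good && (mark2 (Y i) ==> b (+) mark4 (Y i)))
        (upd X i (join (X i) (false, false, b, false)),
         upd Y i (join (Y i) (false, false, b, false)))
    else None
  else Some (good, XY).

Lemma run_members i l good X Y :
  run l (Members good, (X, i), (Y, i)) =
  omap (fun r => (Members r.1, (r.2.1, i + size l), (r.2.2, i + size l)))
    (do_members i l good (X, Y)).
Proof.
elim: l i good X Y => [|b l IH] i good X Y /=; first by rewrite addn0.
rewrite run_cons /=; case: (_ && _); last by rewrite dead_run.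
by rewrite /wact /= IH addSnnS.
Qed.

(** * Marks after each pass *)

Local Notation accepts :=
  (multipass_accepts (false, false, false, false) Count scan restart accept).

Lemma do_statuses_range i l XY XY' : do_statuses i l XY = Some XY' ->
  forall k, mark1 (XY'.1 k) = mark1 (XY.1 k) /\ mark1 (XY'.2 k) = mark1 (XY.2 k).
Proof.
elim: l i XY => [|o l IH] i XY /=; first by case=> ->.
case E : (do_status _ _ _) => [XY1|] //= /IH H k.
by have [-> ->] := H k; apply: do_status_range E k.
Qed.

Lemma do_rule_range XY r XY' : do_rule XY r = Some XY' ->
  forall k, mark1 (XY'.1 k) = mark1 (XY.1 k) /\ mark1 (XY'.2 k) = mark1 (XY.2 k).
Proof.
case: r XY => h a [X Y] /=; case: ifP => // _ [<-] k.
by rewrite /= !mark1_upd.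
Qed.

Lemma do_rules_range l XY XY' : do_rules l XY = Some XY' ->
  forall k, mark1 (XY'.1 k) = mark1 (XY.1 k) /\ mark1 (XY'.2 k) = mark1 (XY.2 k).
Proof.
elim: l XY => [|r l IH] XY /=; first by case=> ->.
case E : (do_rule _ _) => [XY1|] //= /IH H k.
by have [-> ->] := H k; apply: do_rule_range E k.
Qed.

Lemma mark3_upd (X : cells) c d k :
  mark3 d = false -> mark3 (upd X c (join (X c) d) k) = mark3 (X k).
Proof.
by rewrite /upd => E; case: eqP => [->|//]; rewrite /join /mark3 /= [d.1.2]E orbF.
Qed.

Lemma mark24_upd (X : cells) c d k : mark2 d = false -> mark4 d = false ->
  mark2 (upd X c (join (X c) d) k) = mark2 (X k) /\
  mark4 (upd X c (join (X c) d) k) = mark4 (X k).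
Proof.
rewrite /upd => E2 E4; case: eqP => [->|//].
by rewrite /join /mark2 /mark4 /= [d.1.1.2]E2 [d.2]E4 !orbF.
Qed.

Lemma do_statuses_mark3 i l XY XY' : do_statuses i l XY = Some XY' ->
  forall k, mark3 (XY'.2 k) = mark3 (XY.2 k).
Proof.
elim: l i XY => [|o l IH] i XY /=; first by case=> ->.
case: o => [c|] /=; last exact: IH.
by case: ifP => //= _ /IH H k; rewrite H /= mark3_upd.
Qed.

Definition sub_cell (c d : cell) : Prop :=
  [/\ mark1 c -> mark1 d, mark2 c -> mark2 d, mark3 c -> mark3 d
    & mark4 c -> mark4 d].

Definition sub_cells (XY XY' : cells * cells) : Prop :=
  forall k, sub_cell (XY.1 k) (XY'.1 k) /\ sub_cell (XY.2 k) (XY'.2 k).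

Lemma sub_cell_refl c : sub_cell c c.
Proof. by split. Qed.

Lemma sub_cells_refl XY : sub_cells XY XY.
Proof. by move=> k; split; apply: sub_cell_refl. Qed.

Lemma sub_cell_trans d c e : sub_cell c d -> sub_cell d e -> sub_cell c e.
Proof. by move=> [? ? ? ?] [? ? ? ?]; split; auto. Qed.

Lemma sub_cells_trans Y X Z : sub_cells X Y -> sub_cells Y Z -> sub_cells X Z.
Proof.
move=> H1 H2 k; have [a b] := H1 k; have [c d] := H2 k.
by split; apply: sub_cell_trans; eauto.
Qed.

Lemma sub_cell_upd (X : cells) i d k : sub_cell (X k) (upd X i (join (X i) d) k).
Proof.
rewrite /upd; case: eqP => [->|_]; last exact: sub_cell_refl.
by split; rewrite /join /mark1 /mark2 /mark3 /mark4 /= => ->.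
Qed.

Lemma foldl_scanE w s : (if run w s is Some s' then foldl (scan_bit scan) s w = s'
  else ~~ alive (foldl (scan_bit scan) s w)).
Proof. by rewrite /run; case: ifP => // ->. Qed.

(** * Meaning of the marks and soundness of one pass *)

Section Instance.
Variables (n : nat) (sts : seq (option nat)) (rls : seq (nat * nat))
  (mem : seq bool).
Hypotheses (size_sts : size sts = n) (size_mem : size mem = n).

Definition is_asm k := isSome (nth None sts k).
Definition is_contrary c := Some c \in sts.
Definition is_member k := nth false mem k.

Definition in_plus h := is_member h || has (fun r => (r.1 == h) && is_member r.2) rls.

(** Least fixpoint form of leading by rules to an assumption whose contrary lies in A+; rules are
    followed backwards, from head to body. *)
Inductive defeated : nat -> Prop :=
| Defeated_contrary k c of nth None sts k = Some c & in_plus c : defeated k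
| Defeated_rule h a of (h, a) \in rls & defeated h : defeated a.

(** What the automaton tests about the numbers in a parsed word; the second condition is that the
    set of assumptions is non-empty. *)
Definition well_formed : Prop :=
  [/\ forall c, is_contrary c -> c < n, has isSome sts,
      forall h a, (h, a) \in rls -> (is_asm h || is_contrary h) /\ is_asm a
    & forall k, is_member k -> is_asm k].

Definition closed_members : Prop :=
  forall h a, (h, a) \in rls -> is_member a -> is_asm h -> is_member h.

Definition pass_items (XY : cells * cells) : option (bool * (cells * cells)) :=
  obind (fun XY1 => if has isSome sts then
                      obind (do_members 0 mem true) (do_rules rls XY1)
                    else None)
    (do_statuses 0 sts (count_cells n XY.1, count_cells n XY.2)).

(** Implications only: marks are true at all times but complete only after enough passes. *)
Definition sound_left k (c : cell) : Prop :=
  [/\ mark1 c -> k < n, mark2 c -> is_contrary k & mark3 c -> in_plus k].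

Definition sound_right k (c : cell) : Prop :=
  [/\ mark1 c -> k < n, mark2 c -> is_asm k, mark3 c -> is_member k
    & mark4 c -> defeated k].

Definition sound (XY : cells * cells) : Prop :=
  forall k, sound_left k (XY.1 k) /\ sound_right k (XY.2 k).

Lemma sound_left_upd X i d k : (forall k, sound_left k (X k)) ->
  sound_left i d -> sound_left k (upd X i (join (X i) d) k).
Proof.
move=> HX; rewrite /upd; case: eqP => [->|_] // [? ? ?].
have [? ? ?] := HX i.
by split; rewrite /join /mark1 /mark2 /mark3 /= => /orP[]; auto.
Qed.

Lemma sound_right_upd X i d k : (forall k, sound_right k (X k)) ->
  sound_right i d -> sound_right k (upd X i (join (X i) d) k).
Proof.
move=> HX; rewrite /upd; case: eqP => [->|_] // [? ? ? ?].
have [? ? ? ?] := HX i.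
by split; rewrite /join /mark1 /mark2 /mark3 /mark4 /= => /orP[]; auto.
Qed.

Lemma in_plus_member k : is_member k -> in_plus k.
Proof. by rewrite /in_plus => ->. Qed.

Lemma in_plus_rule h a : (h, a) \in rls -> is_member a -> in_plus h.
Proof.
move=> r m; apply/orP; right; apply/hasP; exists (h, a) => //=.
by rewrite eqxx.
Qed.

Lemma do_status_sound i o XY XY' : nth None sts i = o -> sound XY ->
  do_status i o XY = Some XY' ->
  [/\ sound XY', sub_cells XY XY'
    & forall c, o = Some c ->
        [/\ c < n, mark2 (XY'.1 c), mark2 (XY'.2 i)
          & mark3 (XY.1 c) -> mark4 (XY'.2 i)]].
Proof.
move=> io so; case: o io => [c|] io /=; last first.
  by case=> <-; split=> //; apply: sub_cells_refl.
case: ifP => // c1 [<-]; have [[cn _ c3] _] := so c; split=> [k|k|c' [<-]] /=.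
- split; [apply: sound_left_upd|apply: sound_right_upd]; try by move=> j; case: (so j).
    split=> //= _; apply/(nthP None); exists i => //.
    by rewrite ltnNge; apply/negP => /(nth_default None); rewrite io.
  split=> //= [_|m3]; first by rewrite /is_asm io.
  by apply: Defeated_contrary io (c3 _).
- by split; apply: sub_cell_upd.
- rewrite !updE /join /mark2 /mark4 /=; split; rewrite ?orbT //; first exact: cn.
  by move=> ->; rewrite orbT.
Qed.

Lemma do_statuses_sound i l XY XY' :
  (forall j, nth None l j = nth None sts (i + j)) -> sound XY ->
  do_statuses i l XY = Some XY' ->
  [/\ sound XY', sub_cells XY XY'
    & forall j c, nth None l j = Some c ->
        [/\ c < n, mark2 (XY'.1 c), mark2 (XY'.2 (i + j))
          & mark3 (XY.1 c) -> mark4 (XY'.2 (i + j))]].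
Proof.
elim: l i XY => [|o l IH] i XY Hl so /=.
  by case=> <-; split=> // j c; rewrite nth_nil.
case E : (do_status _ _ _) => [XY1|] //=.
have io : nth None sts i = o by rewrite -[i]addn0 -Hl.
have [so1 le1 ef1] := do_status_sound io so E.
move=> /IH[|//|so' le' ef']; first by move=> j; rewrite addSnnS -Hl.
split=> //; first exact: sub_cells_trans le1 le'.
case=> [c /= oc|j c /= /ef'].
  rewrite addn0; have [cn m2 m2' m4] := ef1 c oc.
  have [[_ a2 _ _] _] := le' c; have [_ [_ b2 _ b4]] := le' i.
  by split; auto.
rewrite addSnnS => -[cn a b d]; split=> // m; apply: d.
by have [[_ _ le3 _] _] := le1 c; apply: le3.
Qed.

(** The last three clauses start from the marks present before any rule is read. As marks only grow,
    they hold wherever the rule stands in the list. *)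
Lemma do_rules_sound l XY XY' : {subset l <= rls} -> sound XY ->
  (forall k, is_asm k -> mark2 (XY.2 k)) ->
  do_rules l XY = Some XY' ->
  [/\ sound XY', sub_cells XY XY'
    & forall h a, (h, a) \in l ->
        [/\ is_asm h || is_contrary h, is_asm a,
            mark3 (XY.2 a) -> is_asm h -> is_member h,
            mark3 (XY.2 a) -> mark3 (XY'.1 h)
          & mark4 (XY.2 h) -> mark4 (XY'.2 a)]].
Proof.
elim: l XY => [|[h a] l IH] [X Y] Hl so Ha /=.
  by case=> <-; split=> //; apply: sub_cells_refl.
case: ifP => //= /and3P[m2 m2a /implyP m3] E.
have ra : (h, a) \in rls by apply: Hl; rewrite mem_head.
have so1 : sound (upd X h (join (X h) (false, false, mark3 (Y a), false)),
                  upd Y a (join (Y a) (false, false, false, mark4 (Y h)))).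
  move=> k; split; [apply: sound_left_upd|apply: sound_right_upd];
    try by move=> j; case: (so j).
  - split=> //= m; apply: in_plus_rule ra _.
    by have [_ [_ _ s3 _]] := so a; apply: s3.
  - split=> //= m; apply: Defeated_rule ra _.
    by have [_ [_ _ _ s4]] := so h; apply: s4.
have le1 : sub_cells (X, Y)
   (upd X h (join (X h) (false, false, mark3 (Y a), false)),
    upd Y a (join (Y a) (false, false, false, mark4 (Y h)))).
  by move=> k; split; apply: sub_cell_upd.
have [||so' le' ef'] := IH _ _ so1 _ E.
- by move=> r rl; apply: Hl; rewrite in_cons rl orbT.
- by move=> k /Ha; have [_ [_ + _ _]] := le1 k; apply.
split=> //; first exact: sub_cells_trans le1 le'.
move=> h' a'; rewrite in_cons => /predU1P[[-> ->]|/ef'[c1 c2 c3 c4 c5]].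
- have [_ [_ sa2 sa3 _]] := so a; have [[_ sc2 _] [_ sh2 sh3 _]] := so h.
  have [[_ _ lX _] _] := le' h; have [_ [_ _ _ lY]] := le' a.
  split.
  + by case/orP: m2 => [/sh2|/sc2] ->; rewrite ?orbT.
  + exact: sa2.
  + by move=> ma /Ha hh; apply/sh3/m3; rewrite /= in ma hh; rewrite ma hh.
  + by move=> ma; apply: lX; rewrite /= updE /join /mark3 /= -/(mark3 (Y a)) ma orbT.
  + by move=> mh; apply: lY; rewrite /= updE /join /mark4 /= -/(mark4 (Y h)) mh orbT.
- have [[_ _ _ _] [_ _ l3 _]] := le1 a'; have [[_ _ _ _] [_ _ _ l4]] := le1 h'.
  by split; auto.
Qed.

(** The verdict depends on [mark2] and [mark4], which this segment does not change, so it can be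
    stated with the marks at its start. *)
Lemma do_members_sound i l g g' XY XY' :
  (forall j, nth false l j = is_member (i + j)) -> sound XY ->
  do_members i l g XY = Some (g', XY') ->
  [/\ sound XY', sub_cells XY XY',
      forall k, mark4 (XY'.2 k) = mark4 (XY.2 k),
      forall j, nth false l j ->
        [/\ is_asm (i + j), mark3 (XY'.1 (i + j)) & mark3 (XY'.2 (i + j))]
    & g' <-> g /\ forall j, j < size l -> mark2 (XY.2 (i + j)) ->
                      nth false l j (+) mark4 (XY.2 (i + j))].
Proof.
elim: l i g XY => [|b l IH] i g [X Y] Hl so /=.
  case=> <- <-; split=> // [j|]; first by rewrite nth_nil.
  by split=> [|[]].
case: ifP => // /andP[m1 /implyP bm] E.
have bi : b = is_member i by rewrite -[i]addn0 -Hl.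
set X1 := upd X _ _ in E; set Y1 := upd Y _ _ in E.
have so1 : sound (X1, Y1).
  move=> k; split; [apply: sound_left_upd|apply: sound_right_upd];
    try by move=> j; case: (so j).
    by split=> //=; rewrite /mark3 /= bi; apply: in_plus_member.
  by split=> //=; rewrite /mark3 /= bi.
have le1 : sub_cells (X, Y) (X1, Y1) by move=> k; split; apply: sub_cell_upd.
have Y24 k : mark2 (Y1 k) = mark2 (Y k) /\ mark4 (Y1 k) = mark4 (Y k).
  exact: mark24_upd.
have [|so' le' e4 ef' hg] := IH _ _ _ _ so1 E.
  by move=> j; rewrite addSnnS -Hl.
split=> //; first exact: sub_cells_trans le1 le'.
- by move=> k; rewrite e4 /=; case: (Y24 k).
- case=> [|j] /=; last by rewrite -addSnnS; apply: ef'.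
  rewrite addn0 => b1; have [_ [_ sa _ _]] := so i.
  have [[_ _ lX _] [_ _ lY _]] := le' i; split; first by apply: sa; apply: bm.
    by apply: lX; rewrite /= /X1 updE /join /mark3 /= b1 orbT.
  by apply: lY; rewrite /= /Y1 updE /join /mark3 /= b1 orbT.
- rewrite hg; split.
    case=> /andP[-> /implyP g1] g2; split=> // -[_ /=|j jl /=]; first by rewrite addn0.
    by have := g2 j jl; have [-> ->] := Y24 (i.+1 + j); rewrite addSnnS.
  case=> -> H; split=> [|j jl].
    by apply/implyP => m2; have := H 0 isT; rewrite addn0; apply.
  by have [-> ->] := Y24 (i.+1 + j); rewrite addSnnS; apply: (H j.+1).
Qed.

(** * Closed well-formed instances survive every pass *)

Lemma do_statuses_some i l X Y : (forall c, Some c \in l -> mark1 (X c)) ->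
  do_statuses i l (X, Y) != None.
Proof.
elim: l i X Y => [//|o l IH] i X Y H /=.
have H' c : Some c \in l -> mark1 (X c) by move=> cl; apply: H; rewrite in_cons cl orbT.
case: o H => [c|] H /=; last exact: IH.
rewrite H ?mem_head //=; apply: IH => c' cl; rewrite mark1_upd //; exact: H'.
Qed.

(** The closedness test compares member marks. Were only some members marked, a rule between two
    members could fail because its head is not marked yet; the last hypothesis asks that all members
    be marked or none. *)
Lemma do_rules_some l X Y : {subset l <= rls} -> sound (X, Y) -> closed_members ->
  (forall k, is_asm k -> mark2 (Y k)) ->
  (forall k, is_contrary k -> mark2 (X k)) ->
  (forall h a, (h, a) \in rls -> (is_asm h || is_contrary h) /\ is_asm a) ->
  (forall a h, mark3 (Y a) -> is_member h -> mark3 (Y h)) ->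
  do_rules l (X, Y) != None.
Proof.
elim: l X Y => [//|[h a] l IH] X Y Hl so cl Ha Hc wf Hm.
have ra : (h, a) \in rls by apply: Hl; rewrite mem_head.
have E : do_rule (X, Y) (h, a) = Some
   (upd X h (join (X h) (false, false, mark3 (Y a), false)),
    upd Y a (join (Y a) (false, false, false, mark4 (Y h)))).
  rewrite /= ifT //; have [/orP ha aa] := wf _ _ ra.
  apply/and3P; split; last 1 first.
  - apply/implyP => /andP[ma mh]; apply: (Hm a) => //.
    have [_ [_ _ s3 _]] := so a; have [_ [_ s2 _ _]] := so h.
    by apply: cl ra (s3 ma) (s2 mh).
  - by case: ha => [/Ha|/Hc] ->; rewrite ?orbT.
  - exact: Ha.
have sub1 : {subset [:: (h, a)] <= rls} by move=> r; rewrite inE => /eqP ->.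
have E1 : do_rules [:: (h, a)] (X, Y) = do_rule (X, Y) (h, a).
  by rewrite /=; case: ifP.
rewrite E in E1; have [so1 le1 _] := do_rules_sound sub1 so Ha E1.
have -> : do_rules ((h, a) :: l) (X, Y) =
  obind (do_rules l) (do_rule (X, Y) (h, a)) by [].
rewrite E [obind _ _]/=; apply: IH => //.
- by move=> r rl; apply: Hl; rewrite in_cons rl orbT.
- by move=> k /Ha; have [_ [_ l2 _ _]] := le1 k.
- by move=> k /Hc; have [[_ l2 _ _] _] := le1 k.
- by move=> a' h'; rewrite !mark3_upd //; apply: Hm.
Qed.

Lemma do_members_some i l g X Y :
  (forall j, j < size l -> mark1 (Y (i + j))) ->
  (forall j, nth false l j -> mark2 (Y (i + j))) ->
  do_members i l g (X, Y) != None.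
Proof.
elim: l i g X Y => [//|b l IH] i g X Y H1 H2 /=.
have -> : mark1 (Y i) by have := H1 0 isT; rewrite addn0.
have -> : b ==> mark2 (Y i).
  by apply/implyP => b1; have := H2 0 b1; rewrite addn0.
apply: IH => j jl; rewrite addSnnS; first by rewrite mark1_upd // H1.
have [-> _] := @mark24_upd Y i (false, false, b, false) (i + j.+1) erefl erefl.
exact: H2.
Qed.

Lemma mark1_count (X : cells) k : mark1 (count_cells n X k) = (k < n) || mark1 (X k).
Proof. by rewrite /count_cells; case: ifP => // _; rewrite /join /mark1 /= orbT. Qed.

Lemma mark234_count (X : cells) k :
  [/\ mark2 (count_cells n X k) = mark2 (X k),
      mark3 (count_cells n X k) = mark3 (X k)
    & mark4 (count_cells n X k) = mark4 (X k)].
Proof.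
by rewrite /count_cells; case: ifP => // _;
   rewrite /join /mark2 /mark3 /mark4 /= !orbF.
Qed.

Lemma sound_count X Y : sound (X, Y) -> sound (count_cells n X, count_cells n Y).
Proof.
move=> so k; have [[a1 a2 a3] [b1 b2 b3 b4]] := so k.
rewrite /sound_left /sound_right /= !mark1_count.
have [-> -> _] := mark234_count X k; have [-> -> ->] := mark234_count Y k.
by split; split=> // /orP[|] //; auto.
Qed.

Lemma sub_count X Y : sub_cells (X, Y) (count_cells n X, count_cells n Y).
Proof.
move=> k; rewrite /sub_cell /= !mark1_count.
have [-> -> ->] := mark234_count X k; have [-> -> ->] := mark234_count Y k.
by split; split=> // ->; rewrite orbT.
Qed.

Lemma pass_items_sound XY g XY' : sound XY -> pass_items XY = Some (g, XY') ->
  [/\ sound XY', sub_cells XY XY', well_formed,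
      forall k, is_member k -> mark3 (XY'.1 k) /\ mark3 (XY'.2 k)
    & [/\ forall k c, nth None sts k = Some c -> mark3 (XY.1 c) -> mark4 (XY'.2 k),
          forall h a, (h, a) \in rls ->
            [/\ mark3 (XY.2 a) -> is_asm h -> is_member h,
                mark3 (XY.2 a) -> mark3 (XY'.1 h)
              & mark4 (XY.2 h) -> mark4 (XY'.2 a)]
        & g <-> forall k, is_asm k -> is_member k (+) mark4 (XY'.2 k)]].
Proof.
case: XY => X Y so; rewrite /pass_items /=.
have so0 := sound_count so; have le0 := sub_count X Y.
case E1 : (do_statuses _ _ _) => [[X1 Y1]|] //=.
have [|so1 le1 ef1] := do_statuses_sound _ so0 E1; first by move=> j.
case: ifP => // ne; case E2 : (do_rules _ _) => [[X2 Y2]|] //= E3.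
have Ha k : is_asm k -> mark2 (Y1 k).
  rewrite /is_asm; case E : (nth _ _ _) => [c|] // _.
  by have [_ _ + _] := ef1 _ _ E; rewrite add0n.
have [||so2 le2 ef2] := do_rules_sound _ so1 _ E2; [by []|exact: Ha|].
have [|so3 le3 e4 ef3 gE] := do_members_sound _ so2 E3; first by [].
have le01 := sub_cells_trans le0 le1.
split=> //.
- by apply: sub_cells_trans le3; apply: sub_cells_trans le2.
- split=> //.
  + by move=> c /(nthP None)[k _ Ek]; have [] := ef1 _ _ Ek.
  + by move=> h a /ef2[].
  + by move=> k; have := ef3 k; rewrite add0n => H /H[].
- by move=> k; have := ef3 k; rewrite add0n => H /H[].
- split.
  + move=> k c Ek m; have [[_ _ a3 _] _] := le0 c.
    have [_ _ _ m4] := ef1 _ _ Ek; rewrite e4.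
    by have [_ [_ _ _]] := le2 k; apply; apply: m4; apply: a3.
  + move=> h a r; have [_ _ c3 d3 d4] := ef2 _ _ r.
    have [_ [_ _ l3 _]] := le01 a; have [[_ _ m3 _] _] := le3 h.
    have [_ [_ _ _ l4]] := le01 h; rewrite e4.
    by split=> // m; [apply: c3; apply: l3|apply/m3/d3/l3|apply/d4/l4].
  + rewrite gE; split.
      case=> _ H k ak; rewrite e4; apply: H; last first.
        by rewrite add0n; have [_ [_ l2 _ _]] := le2 k; apply/l2/Ha.
      rewrite size_mem -size_sts ltnNge; apply/negP => /(nth_default None).
      by move: ak; rewrite /is_asm => /[swap] ->.
    move=> H; split=> // j jn m2; rewrite add0n -e4; apply: H.
    by have [_ [_ s2 _ _]] := so2 j; apply: s2.
Qed.

Lemma pass_items_some X Y : sound (X, Y) -> well_formed -> closed_members ->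
  (forall a h, mark3 (Y a) -> is_member h -> mark3 (Y h)) ->
  pass_items (X, Y) != None.
Proof.
move=> so [wf1 wf2 wf3 wf4] cl Hm; rewrite /pass_items /=.
have so0 := sound_count so.
case E1 : (do_statuses _ _ _) => [[X1 Y1]|] /=; last first.
  by have := @do_statuses_some 0 sts (count_cells n X) (count_cells n Y);
     rewrite E1 => /(_ _)/negP; case=> // c /wf1 cn; rewrite mark1_count cn.
have [|so1 le1 ef1] := do_statuses_sound _ so0 E1; first by move=> j.
have Ha k : is_asm k -> mark2 (Y1 k).
  rewrite /is_asm; case E : (nth _ _ _) => [c|] // _.
  by have [_ _ + _] := ef1 _ _ E; rewrite add0n.
have Hc c : is_contrary c -> mark2 (X1 c).
  by move=> /(nthP None)[k _ Ek]; have [_ + _ _] := ef1 _ _ Ek.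
rewrite wf2; case E2 : (do_rules _ _) => [[X2 Y2]|] /=; last first.
  have := @do_rules_some rls X1 Y1 _ so1 cl Ha Hc wf3; rewrite E2.
  apply=> // a h; rewrite !(do_statuses_mark3 E1) /=.
  have [_ -> _] := mark234_count Y a; have [_ -> _] := mark234_count Y h.
  exact: Hm.
have [||so2 le2 _] := do_rules_sound _ so1 _ E2; [by []|exact: Ha|].
apply: do_members_some => j; rewrite add0n.
  rewrite size_mem => jn; have [_ ->] := do_rules_range E2 j.
  have [_ ->] := do_statuses_range E1 j.
  by rewrite /= mark1_count jn.
by move=> /wf4 /Ha; have [_ [_ l2 _ _]] := le2 j.
Qed.

Lemma run_code X Y : sound (X, Y) ->
  run (code n sts rls mem) (Count, (X, 0), (Y, 0)) =
  omap (fun r => (Members r.1, (r.2.1, n), (r.2.2, n))) (pass_items (X, Y)).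
Proof.
move=> so; rewrite /code run_count /pass_items run_statuses; last first.
  by move=> j jn; rewrite mark1_count -size_sts jn.
case E1 : (do_statuses _ _ _) => [[X1 Y1]|] //=; rewrite add0n size_sts.
have Yn : mark1 (Y1 n) = false.
  have [_ ->] := do_statuses_range E1 n; rewrite mark1_count ltnn /=.
  by have [_ [s1 _ _ _]] := so n; apply/negP => /s1; rewrite ltnn.
(* Even an empty rule list is coded by one bit, which serves as lookahead for the end of the
   statuses. *)
have [b [u Eu]] : exists b u, encode_seq code_rule rls ++ mem = b :: u.
  by case: rls => [|r l]; [exists false, mem|rewrite encode_seq_cons; do 2!eexists].
rewrite Eu; case: ifP => _; last exact: run_status_empty.
rewrite run_status_end // -Eu run_rules.
case: (do_rules _ _) => [[X2 Y2]|] //=.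
by rewrite run_members add0n size_mem.
Qed.

(** * Iterated passes and how many are enough *)

Local Notation w := (code n sts rls mem).
Local Notation blanks := ((fun _ => (false, false, false, false),
  fun _ => (false, false, false, false)) : cells * cells).

Definition pass_marks (t : nat) : option (cells * cells) :=
  iter t (obind (fun XY => omap snd (pass_items XY))) (Some blanks).

Local Notation store_after t :=
  (iter t (pass scan restart w) (store0 (false, false, false, false) Count)).

Lemma sound_blanks : sound blanks.
Proof. by []. Qed.

Lemma pass_marksP t :
  if pass_marks t is Some XY then
    sound XY /\ store_after t = (Count, (XY.1, 0), (XY.2, 0))
  else ~~ alive (store_after t).
Proof.
elim: t => [|t] //=; rewrite -/(pass_marks t).
case: (pass_marks t) => [[X Y]|] /=; last first.
  move=> d; have := foldl_scanE w (store_after t); rewrite dead_run // /pass.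
  by case: (foldl _ _ _) => [[q x] y]; case: q.
case=> so ->; have := foldl_scanE w (Count, (X, 0), (Y, 0)); rewrite run_code //.
case E : (pass_items _) => [[g XY']|] /=; rewrite /pass; last first.
  by case: (foldl _ _ _) => [[q x] y]; case: q.
have [so' _ _ _ _] := pass_items_sound so E; move=> -> /=; split=> //.
(* [restart] looks at cell [n], which soundness keeps free of [mark1]. *)
rewrite ifN //; apply/negP; have [_ [s1 _ _ _]] := so' n.
by move/s1; rewrite ltnn.
Qed.

Lemma multipass_accepts_code :
  accepts w =
  if obind pass_items (pass_marks (size w)) is Some (g, _) then g else false.
Proof.
rewrite /multipass_accepts; have := pass_marksP (size w).
case: (pass_marks _) => [[X Y]|] /=; last first.
  move=> d; have := foldl_scanE w (store_after (size w)); rewrite dead_run //.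
  by case: (foldl _ _ _) => [[q x] y]; case: q.
case=> so ->; have := foldl_scanE w (Count, (X, 0), (Y, 0)); rewrite run_code //.
case E : (pass_items _) => [[g XY']|] /=; last first.
  by case: (foldl _ _ _) => [[q x] y]; case: q.
have [so' _ _ _ _] := pass_items_sound so E; move=> -> /=.
have [_ [s1 _ _ _]] := so' n; case: (mark1 _) s1 => [/(_ isT)|_].
  by rewrite ltnn.
by rewrite andbT.
Qed.

Fixpoint defeated_in (j k : nat) : Prop :=
  if j is j'.+1 then exists2 h, (h, k) \in rls & defeated_in j' h
  else exists2 c, nth None sts k = Some c & in_plus c.

(** All sentences on the chain are assumptions: each is the body of a rule or, at the end, has a
    contrary. Once loops are cut they are distinct and below [n], so fewer than [n] rules remain. *)
Lemma defeated_in_bound k : well_formed -> defeated k ->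
  exists2 j, j < n & defeated_in j k.
Proof.
case=> _ _ wf3 _ dk; pose e := [rel a h | (h, a) \in rls].
have [p pk [c pc]] : exists2 p, path e k p & defeated_in 0 (last k p).
  elim: dk => {k} [k c kc c1|h a ha _ [p ph pl]]; first by exists [::] => //; exists c.
  by exists (h :: p) => //=; rewrite ha.
case/shortenP: pk pc => p' pk' up' _ pc c1 {p}.
have asm_lt x : is_asm x -> x < n.
  rewrite -size_sts ltnNge /is_asm => ax; apply/negP => /(nth_default None) E.
  by rewrite E in ax.
exists (size p').
  have /(uniq_leq_size up') : {subset k :: p' <= iota 0 n}.
    move=> x xp; rewrite mem_iota /=; apply: asm_lt.
    elim: p' k xp pk' pc {up' dk} => [|h p' IH] k /=.
      by rewrite inE => /eqP -> _; rewrite /is_asm => ->.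
    rewrite in_cons => /predU1P[->|xp] /andP[kh ph] pc; last exact: IH xp ph pc.
    by have [] := wf3 _ _ kh.
  by rewrite size_iota.
elim: p' k pk' pc {up' dk} => [|h p' IH] k /=; first by move=> _ pc; exists c.
by case/andP=> kh ph pc; exists h => //; apply: IH.
Qed.

(** Membership bits come last, so the rules see all members from the second pass on, which completes
    A+. The statuses come before the rules and see A+ from the third pass on; each later pass
    follows chains at least one rule longer. *)
Lemma pass_marks_progress t XY : pass_marks t.+1 = Some XY ->
  [/\ well_formed, sound XY,
      forall k, is_member k -> mark3 (XY.1 k) /\ mark3 (XY.2 k),
      0 < t -> forall h, in_plus h -> mark3 (XY.1 h)
    & forall j k, j.+1 < t -> defeated_in j k -> mark4 (XY.2 k)].
Proof.
elim: t XY => [|t IH] XY; rewrite /pass_marks iterS -/(pass_marks _).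
  rewrite /pass_marks /=; case E : (pass_items _) => [[g XY1]|] //= [<-].
  by have [so' _ wf H _] := pass_items_sound sound_blanks E.
case E0 : (pass_marks t.+1) => [XY0|] //=.
case E : (pass_items _) => [[g XY1]|] //= [<-] {XY}.
have [wf so0 H0 P0 D0] := IH _ E0.
have [so1 le1 _ H1 [A1 R1 _]] := pass_items_sound so0 E.
split=> // [_ h|j k jt].
  case/orP=> [/H1[]//|/hasP[[h' a] r /andP[/eqP/= hh ma]]].
  by have [_ + _] := R1 _ _ r; rewrite hh; apply; case: (H0 a ma).
case: j jt => [|j] jt /=.
  case=> c kc pc; apply: A1 kc _; apply: P0 pc; lia.
case=> h r dh; have [_ _] := R1 _ _ r; apply; apply: D0 dh; lia.
Qed.

(** Hence there are at least [n + 3] passes, while a chain of [j < n] rules is completely marked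
    after [j + 3]. *)
Lemma size_code : n.+1 < size w.
Proof.
rewrite /code !size_cat /encode_nat size_rcons size_nseq.
by rewrite /encode_seq size_rcons; lia.
Qed.

Lemma multipass_acceptsP :
  accepts w <->
  [/\ well_formed, closed_members
    & forall k, is_asm k -> (is_member k <-> ~ defeated k)].
Proof.
rewrite multipass_accepts_code; have := size_code.
case: (size w) => [//|N] nN; split.
  case E0 : (pass_marks N.+1) => [XY|] //=.
  case E : (pass_items XY) => [[g XY']|] //= g1.
  have EN : pass_marks N.+2 = Some XY'
    by rewrite /pass_marks iterS -/(pass_marks _) E0 /= E.
  have [wf so H _ _] := pass_marks_progress E0.
  have [_ so' _ _ D'] := pass_marks_progress EN.
  have [_ _ _ _ [_ R]] := pass_items_sound so E; rewrite g1 => -[/(_ isT) G _].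
  split=> // [h a r ma ah|k ak].
    (* All members were marked before the last pass, so its tests cover every rule. *)
    by have [c _ _] := R _ _ r; apply: c => //; case: (H a ma).
  have := G k ak; have [_ [_ _ _ s4]] := so' k; case: is_member => /= m4.
    split=> // _ /(defeated_in_bound wf)[j jn dj].
    by rewrite (D' _ _ _ dj) // in m4; lia.
  by split=> // nd; case: nd; apply: s4.
case=> wf cl fin.
have alive_marks t : pass_marks t != None.
  elim: t => [//|t]; rewrite /pass_marks iterS -/(pass_marks t).
  have := pass_marksP t; case E : (pass_marks t) => [[X Y]|] //= [so _] _.
  suff : pass_items (X, Y) != None by case: pass_items.
  (* No member is marked before the first pass, all are marked before any later one. *)
  apply: pass_items_some => // a h; case: t E => [[_ <-]|t E] //.
  by have [_ _ H _ _] := pass_marks_progress E; move=> _ /H[].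
have := pass_marksP N.+1; have := alive_marks N.+1.
case E0 : (pass_marks N.+1) => [XY|] // _ [so _].
have := alive_marks N.+2.
rewrite {1}/pass_marks iterS -/(pass_marks N.+1) E0 /=.
case E : (pass_items XY) => [[g XY']|] //= _.
have EN : pass_marks N.+2 = Some XY'
  by rewrite /pass_marks iterS -/(pass_marks _) E0 /= E.
have [_ so' _ _ D'] := pass_marks_progress EN.
have [_ _ _ _ [_ _ ->]] := pass_items_sound so E => k ak.
have [_ [_ _ _ s4]] := so' k; have := fin k ak.
case: is_member => -[f1 f2] /=.
  by apply/negP => /s4; apply: f1.
case m4 : (mark4 _) => //; suff: false by [].
apply: f2 => /(defeated_in_bound wf)[j jn dj].
by rewrite (D' _ _ _ dj) // in m4; lia.
Qed.
End Instance.

(** * Accepted words are well-formed encodings *)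

(** What [restart] and [accept] both require at the end of a pass: the membership bits have used up
    exactly the marked cells. *)
Definition complete (s : automaton_store) : bool :=
  (if s.1.1 is Members _ then true else false) && ~~ mark1 (s.2.1 s.2.2).

Definition ends (u : seq bool) (s : automaton_store) : bool :=
  if run u s is Some s' then complete s' else false.

Lemma ones_phase m s :
  match s.1.1 with Count | Contrary | Head | BodyNum _ _ _ => true | _ => false end ->
  (foldl (scan_bit scan) s (nseq m true)).1.1 = s.1.1.
Proof. by elim: m s => [//|m IH] [[q x] y]; case: q => //= *; rewrite IH. Qed.

Lemma ends_ones m s :
  match s.1.1 with Count | Contrary | Head | BodyNum _ _ _ => true | _ => false end ->
  ends (nseq m true) s = false.
Proof.
move=> H; have := ones_phase m H; rewrite /ends /run.
by case: (foldl _ _ _) => [[q x] y] /= ->; move: H; case: (s.1.1).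
Qed.

Lemma ones_prefix u :
  (exists k u', u = encode_nat k ++ u') \/ u = nseq (size u) true.
Proof.
elim: u => [|[] u IH]; [by right| |by left; exists 0, u].
case: IH => [[k [u' ->]]|E]; last by right; rewrite /= -E.
by left; exists k.+1, u'.
Qed.

(** Ones do not change any of these phases and none of them is final, so a successful pass must meet
    a zero. *)
Lemma ends_unary u s :
  match s.1.1 with Count | Contrary | Head | BodyNum _ _ _ => true | _ => false end ->
  ends u s -> exists k u', u = encode_nat k ++ u'.
Proof. by move=> H; case: (ones_prefix u) => // ->; rewrite ends_ones. Qed.

(** The parse is driven by the tape: [m] counts the marked cells still ahead of the second head. *)
Lemma ends_statuses n m i ne u X Y : i + m = n ->
  (forall j, mark1 (Y j) = (j < n)) -> ends u (Status ne, (X, 0), (Y, i)) ->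
  exists l u' X' Y',
    [/\ size l = m, u = flatten (map code_status l) ++ u',
        forall j, mark1 (Y' j) = (j < n) & ends u' (Rules, (X', 0), (Y', 0))].
Proof.
elim: m i ne u X Y => [|m IH] i ne u X Y im HY.
  rewrite addn0 in im; rewrite im; case: u => [//|b u].
  have Yn : mark1 (Y n) = false by rewrite HY ltnn.
  case: ne; rewrite /ends ?run_status_empty // run_status_end // => E.
  by exists [::], (b :: u), X, Y.
have Yi : mark1 (Y i) by rewrite HY; lia.
have step o u' : ends (code_status o ++ u') (Status ne, (X, 0), (Y, i)) ->
  exists l u'' X' Y', [/\ size l = m.+1,
    code_status o ++ u' = flatten (map code_status l) ++ u'',
    forall j, mark1 (Y' j) = (j < n) & ends u'' (Rules, (X', 0), (Y', 0))].
  rewrite /ends run_status //; case E : (do_status _ _ _) => [[X1 Y1]|] //= e1.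
  have [||l [u'' [X' [Y' [sl -> HY' e']]]]] := IH i.+1 _ u' X1 Y1 _ _ e1; first lia.
    by move=> j; have [_ ->] := do_status_range E j; apply: HY.
  by exists (o :: l), u'', X', Y'; split=> //=; rewrite ?sl // catA.
case: u => [//|[] u]; last exact: (step None).
(* The store inside the contrary only shows that its unary code ends; the run is then replayed over
   the whole status. *)
move=> e; have [|c [u' Eu]] := @ends_unary u (Contrary, (X, 0),
  (upd Y i (join (Y i) (false, true, false, false)), i)) isT.
  by move: e; rewrite /ends run_cons /= Yi /wact /= upd_id.
by rewrite Eu in e *; apply: (step (Some c)).
Qed.

Lemma code_ruleE h a u : code_rule (h, a) ++ u =
  nseq h true ++ [:: false, true & nseq a true ++ [:: false, false & u]].
Proof.
rewrite /code_rule -catA encode_natE.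
have -> : encode_seq encode_nat [:: a] = rcons (true :: encode_nat a) false.
  by rewrite /encode_seq /= cats0.
by rewrite cat_rcons /= encode_natE.
Qed.

(** Following the run bit by bit recovers the code of the first rule; [run_rule] then replays it,
    and induction on the length handles the rest. *)
Lemma ends_rules n u X Y :
  (forall j, mark1 (Y j) = (j < n)) -> ends u (Rules, (X, 0), (Y, 0)) ->
  exists l u' X' Y',
    [/\ u = encode_seq code_rule l ++ u',
        forall j, mark1 (Y' j) = (j < n) & ends u' (Members true, (X', 0), (Y', 0))].
Proof.
have [m] := ubnP (size u); elim: m u X Y => // m IH u X Y um HY.
case: u um => [//|[] u] um; last first.
  rewrite /ends run_cons /= /wact /= !upd_id => e.
  by exists [::], u, X, Y.
move=> e0; have e : ends u (Head, (X, 0), (Y, 0)).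
  by move: e0; rewrite /ends run_cons /= /wact /= !upd_id.
have [//|h [u1 Eu]] := ends_unary _ e; rewrite {}Eu in um e0 e *.
move: e; rewrite /ends encode_natE run_head run_cons /= !add0n.
case: (_ || _); last by rewrite dead_run.
rewrite /wact /= !upd_id; case: u1 um e0 => [//|[] u2] um e0; last first.
  by rewrite run_cons /= dead_run.
rewrite run_cons /= /wact /= !upd_id => e.
have [//|a [u3 Eu]] := ends_unary _ e; rewrite {}Eu in um e0 e *.
move: e; rewrite encode_natE run_body run_cons /= !add0n.
case: (_ && _); last by rewrite dead_run.
rewrite /wact /=; case: u3 um e0 => [//|[] u'] um e0.
  by rewrite run_cons /= dead_run.
move=> _; have Eu : true :: encode_nat h ++ true :: encode_nat a ++ false :: u' =
    true :: code_rule (h, a) ++ u' by rewrite code_ruleE !encode_natE.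
rewrite Eu in um e0; move: e0; rewrite /ends run_rule.
case E : (do_rule _ _) => [[X1 Y1]|] //= e1.
have [||l [u'' [X' [Y' [-> HY' e']]]]] := IH u' X1 Y1 _ _ e1.
- by move: um; rewrite /= size_cat; lia.
- by move=> j; have [_ ->] := do_rule_range E j; apply: HY.
exists ((h, a) :: l), u'', X', Y'; split=> //.
rewrite (encode_seq_cons code_rule) cat_cons -catA.
by rewrite code_ruleE.
Qed.

Lemma do_members_range i l g XY r : do_members i l g XY = Some r ->
  (forall k, mark1 (r.2.2 k) = mark1 (XY.2 k)) /\
  (forall j, j < size l -> mark1 (XY.2 (i + j))).
Proof.
elim: l i g XY => [|b l IH] i g [X Y] /=; first by case=> <-.
case: ifP => // /andP[m1 _] /IH /= [H1 H2].
have E k : mark1 (upd Y i (join (Y i) (false, false, b, false)) k) = mark1 (Y k).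
  exact: mark1_upd.
split=> [k|[|j] jl]; first by rewrite H1 E.
  by rewrite addn0.
by rewrite -addSnnS -E H2.
Qed.

(** A surplus bit kills the automaton on cell [n], a missing one leaves the head on a marked
    cell. *)
Lemma ends_members n u X Y : (forall j, mark1 (Y j) = (j < n)) ->
  ends u (Members true, (X, 0), (Y, 0)) -> size u = n.
Proof.
move=> HY; rewrite /ends run_members.
case E : (do_members _ _ _ _) => [[g [X' Y']]|] //=.
have [H1 H2] := do_members_range E; rewrite /complete /= add0n.
rewrite [mark1 _]H1 /= HY -leqNgt => nu; apply/eqP; rewrite eqn_leq nu andbT.
rewrite leqNgt; apply/negP => /H2.
by rewrite /= HY add0n ltnn.
Qed.

Lemma dead_pass w s : ~~ alive s -> ~~ alive (pass scan restart w s).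
Proof.
move=> d; have := foldl_scanE w s; rewrite dead_run // /pass.
by case: (foldl _ _ _) => [[q x] y]; case: q.
Qed.

(** Death is permanent, so acceptance forces the first pass to succeed, and the parse is read off
    that pass. *)
Lemma accepts_code w : accepts w ->
  exists n sts rls mem,
    [/\ size sts = n, size mem = n & w = code n sts rls mem].
Proof.
pose s0 := store0 (false, false, false, false) Count.
suff H : accepts w -> ends w s0.
  move=> /H {H} e; have [//|n [u Eu]] := ends_unary _ e; rewrite {}Eu {w} in e *.
  move: e; rewrite /ends run_count => e.
  have [||sts [u1 [X1 [Y1 [<- -> HY1]]]]] := @ends_statuses n n 0 _ _ _ _ _ _ e => //.
    by move=> j; rewrite mark1_count orbF.
  case/(ends_rules HY1) => rls [mem [X2 [Y2 [-> HY2 /(ends_members HY2) sm]]]].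
  by exists (size sts), sts, rls, mem.
rewrite /multipass_accepts -/s0.
case Ew : w => [//|b w']; rewrite -Ew; have -> : size w = (size w').+1 by rewrite Ew.
rewrite iterSr; have [a1|d1] := boolP (alive (pass scan restart w s0)); last first.
  have : ~~ alive (iter (size w') (pass scan restart w) (pass scan restart w s0)).
    by elim: (size w') => [//|k IH] /=; apply: dead_pass.
  move=> d; have := foldl_scanE w
    (iter (size w') (pass scan restart w) (pass scan restart w s0)).
  by rewrite dead_run //; case: (foldl _ _ _) => [[q x] y]; case: q.
move: a1; have := foldl_scanE w s0; rewrite /ends /pass.
case: (run _ _) => [s ->|]; last by case: (foldl _ _ _) => [[q x] y]; case: q.
by case: s => [[q x] y]; case: q => //= g; rewrite /complete /=; case: (mark1 _).
Qed.

(** * Frameworks and their encodings *)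

Section Framework.
Variables (F : aba) (A : {set asm F}).
Hypothesis bipolarF : bipolar F.

(** A bipolar deduction seen as a chain from its only leaf, with the root rule outermost. *)
Inductive derives (a : asm F) : sentence F -> Prop :=
| derives_refl : derives a (val a)
| derives_rule phi (b : asm F) of derives a (val b) & (phi, [:: val b]) \in rules F :
    derives a phi.

Lemma rules_used_sub phi (d : deduction phi) : {subset rules_used d <= rules F}.
Proof.
elim: d => [a|r rF ch IH] //= x.
rewrite in_cons => /predU1P[->//|/flattenP[s /mapP[i _ ->]]]; exact: IH.
Qed.

Lemma deduction_derives phi (d : deduction phi) :
  exists2 a : asm F, leaves d = [set a] & derives a phi.
Proof.
elim: d => [a|[h l] rF ch IH] /=; first by exists a => //; apply: derives_refl.
have [b [/= lb _]] := bipolarF rF; subst l.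
have [a La da] := IH ord0; exists a; last exact: derives_rule da rF.
by rewrite (big_ord1 _ (fun i => leaves (ch i))).
Qed.

Lemma derives_deduction a phi : derives a phi ->
  exists d : deduction phi, leaves d = [set a].
Proof.
elim=> {phi} [|phi b _ [d dL] r]; first by exists (Assumption a).
(* The type of a child depends on its index, so the child is built together with its leaf set after
   reducing the index to [ord0]. *)
have ch (i : 'I_1) :
  {d' : deduction (tnth (in_tuple [:: val b]) i) | leaves d' = [set a]}.
  by rewrite (ord1 i); exists d.
exists (@ByRule F (phi, [:: val b]) r (fun i => projT1 (ch i))) => /=.
by rewrite (big_ord1 _ (fun i => leaves (projT1 (ch i)))); case: (ch _).
Qed.

Lemma deducible_derives phi (B : {set asm F}) :
  (exists A' R, [/\ deducible A' R phi, A' \subset B & {subset R <= rules F}])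
  <-> exists2 a, a \in B & derives a phi.
Proof.
split=> [[A' [R [[d [dA _]] AB _]]]|[a aB /derives_deduction[d dL]]].
  have [a La da] := deduction_derives d; exists a => //.
  by apply: (subsetP AB); rewrite -dA La inE.
exists [set a], (rules_used d); split; last exact: rules_used_sub.
  by exists d.
by rewrite sub1set.
Qed.

Lemma attacks_derives (B C : {set asm F}) :
  attacks B C <-> exists2 c, c \in C & exists2 a, a \in B & derives a (contrary c).
Proof.
split=> [[c [A' [R [cC dA AB RF]]]]|[c cC /deducible_derives[A' [R [dA AB RF]]]]].
  by exists c => //; apply/deducible_derives; exists A', R.
by exists c, A', R.
Qed.

Lemma in_Cl (B : {set asm F}) c : c \in Cl B <-> exists2 a, a \in B & derives a (val c).
Proof. by rewrite inE -deducible_derives; split => /asboolP. Qed.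

Lemma derives_trans a b phi : derives a (val b) -> derives b phi -> derives a phi.
Proof. by move=> ab; elim=> // {}phi c _ /derives_rule; apply. Qed.

Definition rank (x : sentence F) : nat := enum_rank x.

Lemma rank_inj : injective rank.
Proof. by move=> x y /ord_inj/enum_rank_inj. Qed.

Lemma rank_lt x : rank x < #|sentence F|.
Proof. exact: ltn_ord. Qed.

Definition statuses : seq (option nat) :=
  [seq omap (fun a : asm F => rank (contrary a)) (insub x) | x : sentence F].

(** The default [0] stands for an empty body, which a bipolar framework excludes. *)
Definition rule_ranks : seq (nat * nat) :=
  [seq (rank r.1, if r.2 is x :: _ then rank x else 0) | r <- rules F].

Definition memberships : seq bool :=
  [seq x \in [set val a | a in A] | x : sentence F].

Lemma size_statuses : size statuses = #|sentence F|.
Proof. by rewrite size_image. Qed.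

Lemma size_memberships : size memberships = #|sentence F|.
Proof. by rewrite size_image. Qed.

Lemma nth_image_rank (T : Type) (f : sentence F -> T) d x :
  nth d [seq f y | y : sentence F] (rank x) = f x.
Proof. by rewrite (nth_map x) ?nth_enum_rank // -cardE rank_lt. Qed.

Lemma rank_surj k : k < #|sentence F| -> exists x, k = rank x.
Proof. by move=> kn; exists (enum_val (Ordinal kn)); rewrite /rank enum_valK. Qed.

Lemma encode_code :
  encode A = code #|sentence F| statuses rule_ranks memberships.
Proof.
rewrite /encode /code; congr (_ ++ (_ ++ (_ ++ _))).
  congr flatten; rewrite -map_comp; apply: eq_map => x /=.
  by rewrite /encode_status; case: insub.
rewrite /encode_seq -map_comp; congr (rcons (flatten _) _); apply/eq_in_map => r rF /=.
by have [b [E _]] := bipolarF rF; rewrite /encode_rule E.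
Qed.

Local Notation is_asm := (is_asm statuses).
Local Notation is_contrary := (is_contrary statuses).
Local Notation is_member := (is_member memberships).
Local Notation defeated := (defeated statuses rule_ranks memberships).
Local Notation in_plus := (in_plus rule_ranks memberships).

Lemma status_val (a : asm F) :
  nth None statuses (rank (val a)) = Some (rank (contrary a)).
Proof. by rewrite nth_image_rank valK. Qed.

Lemma is_asm_rank x : is_asm (rank x) = (x \in assumptions F).
Proof.
rewrite /is_asm nth_image_rank.
by case: insubP => [a xa _|/negbTE] //=.
Qed.

Lemma is_asmP k : is_asm k -> exists a : asm F, k = rank (val a).
Proof.
move=> ak; have kn : k < #|sentence F|.
  rewrite -size_statuses ltnNge; apply/negP => /(nth_default None) E.
  by rewrite /is_asm E in ak.
have [x Ex] := rank_surj kn; rewrite Ex is_asm_rank in ak *.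
by exists (Sub x ak).
Qed.

Lemma is_contraryP k : is_contrary k <-> exists a : asm F, k = rank (contrary a).
Proof.
split=> [/(nthP None)[i _ Ei]|[a ->]]; last first.
  by apply/(nthP None); exists (rank (val a));
    rewrite ?status_val // size_statuses rank_lt.
have /is_asmP[a Ea] : is_asm i by rewrite /is_asm Ei.
by exists a; move: Ei; rewrite Ea status_val => -[].
Qed.

Lemma is_member_val (a : asm F) : is_member (rank (val a)) = (a \in A).
Proof. by rewrite /is_member nth_image_rank mem_imset //; apply: val_inj. Qed.

Lemma is_memberP k : is_member k -> exists2 a, a \in A & k = rank (val a).
Proof.
move=> mk; have kn : k < #|sentence F|.
  rewrite -size_memberships ltnNge; apply/negP => /(nth_default false) E.
  by rewrite /is_member E in mk.
have [x Ex] := rank_surj kn; rewrite Ex /is_member nth_image_rank in mk.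
by case/imsetP: mk => a aA xa; exists a; rewrite // Ex xa.
Qed.

Lemma rule_rankP h k : (h, k) \in rule_ranks ->
  exists phi (a : asm F),
    [/\ h = rank phi, k = rank (val a), (phi, [:: val a]) \in rules F
      & phi \in assumptions F \/ exists b : asm F, phi = contrary b].
Proof.
case/mapP=> -[phi l] rF [-> ->]; have [a [/= la H]] := bipolarF rF.
by subst l; exists phi, a.
Qed.

Lemma rule_rank_mem phi (a : asm F) : (phi, [:: val a]) \in rules F ->
  (rank phi, rank (val a)) \in rule_ranks.
Proof. by move=> rF; apply/mapP; exists (phi, [:: val a]). Qed.

Lemma bipolar_well_formed : well_formed #|sentence F| statuses rule_ranks memberships.
Proof.
split.
- by move=> c /is_contraryP[a ->]; apply: rank_lt.
- have /set0Pn[x xa] := assumptions_neq0 F.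
  apply/(has_nthP None); exists (rank x); first by rewrite size_statuses rank_lt.
  by have := is_asm_rank x; rewrite xa.
- move=> h k /rule_rankP[phi [a [-> -> _ H]]].
  rewrite !is_asm_rank (valP a); split=> //; apply/orP.
  case: H => [H|[b ->]]; first by left.
  by right; apply/is_contraryP; exists b.
- by move=> k /is_memberP[a _ ->]; rewrite is_asm_rank (valP a).
Qed.

(** Every intermediate sentence of a chain is an assumption, so closure under single rules
    propagates along the chain. *)
Lemma closed_members_closed :
  closed_members statuses rule_ranks memberships <-> is_closed A.
Proof.
split=> [cl|cl h k]; last first.
  case/rule_rankP=> phi [a [-> -> rF _]]; rewrite is_member_val is_asm_rank => aA phiF.
  rewrite -[phi]/(val (Sub phi phiF : asm F)) is_member_val cl; apply/in_Cl.
  by exists a => //; apply: derives_rule rF; apply: derives_refl.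
apply/setP => b; apply/idP/idP => [bA|/in_Cl[a aA]].
  by apply/in_Cl; exists b => //; apply: derives_refl.
move Ephi : (val b) => phi d.
elim: d b Ephi => {phi} [b /val_inj -> //|phi c _ IH r b Eb].
rewrite -is_member_val; apply: (cl _ (rank (val c))).
- by apply: rule_rank_mem; rewrite Eb.
- by rewrite is_member_val; apply: IH.
- by rewrite is_asm_rank (valP b).
Qed.

(** A chain from a closed set can leave it only by its last rule. *)
Lemma in_plus_derives phi : is_closed A ->
  in_plus (rank phi) <-> exists2 a, a \in A & derives a phi.
Proof.
move=> cl; split.
  case/orP => [/is_memberP[a aA /rank_inj ->]|/hasP[[h k] /rule_rankP]].
    by exists a => //; apply: derives_refl.
  case=> psi [a [-> -> rF _]] /andP[/eqP/rank_inj /= <-].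
  rewrite is_member_val => aA; exists a => //.
  by apply: derives_rule rF; apply: derives_refl.
case=> a aA d; case: d => {phi} [|phi b ab rF].
  by apply: in_plus_member; rewrite is_member_val.
apply: in_plus_rule (rule_rank_mem rF) _.
by rewrite is_member_val cl; apply/in_Cl; exists a.
Qed.

Lemma defeated_asm k : defeated k -> is_asm k.
Proof.
case=> {k} [k c kc _|h k r _]; first by rewrite /is_asm kc.
by have [_ _ H _] := bipolar_well_formed; case: (H _ _ r).
Qed.

(** [defeated] extends a chain at its start, [derives] at its end: one direction prepends a rule by
    [derives_trans], the other pushes defeat back along the derivation. *)
Lemma defeatedP (a : asm F) : defeated (rank (val a)) <->
  exists2 b : asm F, derives a (val b) & in_plus (rank (contrary b)).
Proof.
split=> [|[b]].
  move Ek : (rank (val a)) => k d; elim: d a Ek => {k} [k c kc pc|h k r dh IH] a Ek.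
    exists a; first exact: derives_refl.
    by move: kc pc; rewrite -Ek status_val => -[->].
  have [c Ec] := is_asmP (defeated_asm dh).
  have [b cb pb] := IH c (esym Ec); exists b => //.
  case/rule_rankP: r => phi [a' [Ephi Ea' rF _]].
  apply: derives_trans cb; apply: derives_rule (derives_refl a) _.
  have -> : val c = phi by apply: rank_inj; rewrite -Ec.
  by have -> : val a = val a' by apply: rank_inj; rewrite Ek.
move Ephi : (val b) => phi d pb.
have {pb} : defeated (rank phi).
  by rewrite -Ephi; apply: Defeated_contrary (status_val b) pb.
move=> {b Ephi}; elim: d => {phi} [//|phi b _ IH rF dphi]; apply: IH.
exact: Defeated_rule (rule_rank_mem rF) dphi.
Qed.

Lemma set_stable_marks : set_stable A <->
  closed_members statuses rule_ranks memberships /\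
  forall k, is_asm k -> (is_member k <-> ~ defeated k).
Proof.
have attacks_defeated a : is_closed A ->
    attacks A (Cl [set a]) <-> defeated (rank (val a)).
  move=> cl; rewrite attacks_derives defeatedP; split.
    case=> b /in_Cl[a' /set1P -> ab] H; exists b => //.
    exact/in_plus_derives.
  case=> b ab /(in_plus_derives _ cl) H; exists b => //.
  by apply/in_Cl; exists a => //; rewrite inE.
split=> [[cl cf st]|[/closed_members_closed cl fin]].
  split; first exact/closed_members_closed.
  move=> k /is_asmP[a ->]; rewrite is_member_val; split.
    (* By closedness the attacked [b] is itself a member, against conflict-freeness. *)
    move=> aA /defeatedP[b ab /(in_plus_derives _ cl) H]; apply: cf.
    apply/attacks_derives; exists b => //.
    by rewrite cl; apply/in_Cl; exists a.
  move=> nd; apply: contrapT => /negP aA; apply: nd.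
  by apply/attacks_defeated => //; apply: st.
split=> //.
  (* An attacked member is defeated through the empty chain. *)
  move=> /attacks_derives[b bA H].
  have [|f _] := fin (rank (val b)); first by rewrite is_asm_rank (valP b).
  apply: f; first by rewrite is_member_val.
  apply/defeatedP; exists b; first exact: derives_refl.
  exact/in_plus_derives.
move=> a aA; apply/attacks_defeated => //; apply: contrapT => nd.
have [|_ f] := fin (rank (val a)); first by rewrite is_asm_rank (valP a).
by move: (f nd); rewrite is_member_val (negbTE aA).
Qed.
End Framework.

Lemma encode_accepts (F : aba) (A : {set asm F}) :
  bipolar F -> accepts (encode A) <-> set_stable A.
Proof.
move=> bF; rewrite (encode_code A bF) set_stable_marks //.
rewrite multipass_acceptsP ?size_statuses ?size_memberships //.
have wf := bipolar_well_formed A bF.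
by split=> [[]|[]].
Qed.

(** * Reading a framework back from a well-formed word *)

Section Decode.
Variables (n : nat) (sts : seq (option nat)) (rls : seq (nat * nat)) (mem : seq bool).
Hypotheses (size_sts : size sts = n.+1) (size_mem : size mem = n.+1).
Hypothesis wf : well_formed n.+1 sts rls mem.

Let asms : {set 'I_n.+1} := [set i : 'I_n.+1 | is_asm sts i].

Lemma decode_asms_neq0 : asms != set0.
Proof.
have [_ /(has_nthP None)[i ni si] _ _] := wf; apply/set0Pn.
by exists (inord i); rewrite inE inordK // -size_sts.
Qed.

Definition decode_rule (r : nat * nat) : 'I_n.+1 * seq 'I_n.+1 :=
  (inord r.1, [:: inord r.2]).

(** Sentences are ordinals, so that ranks are the numbers of the word. Well-formedness keeps the
    relevant numbers in range and gives each assumption a contrary, so the defaults of [inord] and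
    [odflt] are never met. *)
Definition decode : aba :=
  @ABA 'I_n.+1 (map decode_rule rls) asms decode_asms_neq0
    (fun x => inord (odflt 0 (nth None sts (val x)))).

Definition decode_set : {set asm decode} :=
  [set a : asm decode | is_member mem (val (val a))].

Lemma asm_lt k : is_asm sts k -> k < n.+1.
Proof.
rewrite -size_sts ltnNge /is_asm => ak; apply/negP => /(nth_default None) E.
by rewrite E in ak.
Qed.

Lemma rank_decode (i : 'I_n.+1) : rank (i : sentence decode) = i.
Proof. by rewrite /rank /= enum_rank_ord. Qed.

Lemma card_decode : #|sentence decode| = n.+1.
Proof. exact: card_ord. Qed.

Lemma status_decode (a : asm decode) :
  exists2 c, nth None sts (val (val a)) = Some c & rank (contrary a) = c.
Proof.
have := valP a; rewrite inE /is_asm; case E : (nth _ _ _) => [c|] // _.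
exists c => //; rewrite rank_decode /= E /= inordK //.
have [H _ _ _] := wf; apply: H; apply/(nthP None); exists (val (val a)) => //.
by rewrite size_sts; apply: ltn_ord (val a).
Qed.

Lemma statuses_decode : statuses decode = sts.
Proof.
apply: (@eq_from_nth _ None) => [|i]; first by rewrite size_statuses card_decode.
rewrite size_statuses card_decode => ni.
rewrite -[i in LHS](rank_decode (Ordinal ni)) nth_image_rank.
case: insubP => [a aF va|] /=.
  by have [c] := status_decode a; rewrite va /= => -> ->.
by rewrite inE /is_asm /=; case: (nth _ _ _).
Qed.

Lemma rule_ranks_decode : rule_ranks decode = rls.
Proof.
rewrite /rule_ranks /= -map_comp -[RHS]map_id; apply/eq_in_map => -[h a] r /=.
have [wf1 _ wf3 _] := wf; have [/orP ha /asm_lt an] := wf3 _ _ r.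
have hn : h < n.+1 by case: ha => [/asm_lt|/wf1].
by rewrite !rank_decode !inordK.
Qed.

Lemma memberships_decode : memberships decode_set = mem.
Proof.
apply: (@eq_from_nth _ false) => [|i]; first by rewrite size_memberships card_decode.
rewrite size_memberships card_decode => ni.
rewrite -[i in LHS](rank_decode (Ordinal ni)) nth_image_rank.
apply/imsetP/idP => [[a]|mi]; first by rewrite inE => ma E; rewrite /is_member -E in ma.
have [_ _ _ /(_ _ mi) ai] := wf.
have iF : Ordinal ni \in assumptions decode by rewrite inE.
by exists (Sub (Ordinal ni) iF : asm decode); rewrite ?inE.
Qed.

Lemma bipolar_decode : bipolar decode.
Proof.
move=> _ /mapP[[h a] r ->] /=; have [wf1 _ wf3 _] := wf.
have [/orP ha aa] := wf3 _ _ r.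
have aF : (inord a : sentence decode) \in assumptions decode.
  by rewrite inE inordK // asm_lt.
exists (Sub (inord a : sentence decode) aF : asm decode); split=> //.
case: ha => [ha|hc]; first by left; rewrite inE inordK // asm_lt.
right; case/(nthP None): (hc) => i ni Ei; rewrite size_sts in ni.
have iF : Ordinal ni \in assumptions decode by rewrite inE /is_asm /= Ei.
by exists (Sub (Ordinal ni) iF : asm decode); rewrite /= Ei.
Qed.

Lemma code_decode : code n.+1 sts rls mem = encode decode_set.
Proof.
rewrite (encode_code _ bipolar_decode) card_decode statuses_decode.
by rewrite rule_ranks_decode memberships_decode.
Qed.
End Decode.

Lemma accepts_encode w : accepts w ->
  exists (F : aba) (A : {set asm F}), bipolar F /\ w = encode A.
Proof.
move=> aw; have [[|n] [sts [rls [mem [s1 s2 Ew]]]]] := accepts_code aw;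
  move: aw; rewrite Ew => /(multipass_acceptsP _ s1 s2)[wf _ _].
  (* Without sentences there would be no assumption. *)
  by have [_] := wf; rewrite (size0nil s1).
exists (decode s1 wf), (decode_set s1 wf); split; first exact: bipolar_decode.
exact: code_decode.
Qed.

Theorem proposition3p8 :
  in_P (fun w : seq bool =>
    exists (F : aba) (A : {set asm F}),
      [/\ bipolar F, w = encode A & set_stable A]).
Proof.
have [M [p Mp]] := in_P_multipass (false, false, false, false) Count scan restart accept.
exists M, p => w; have [b [Mb ab]] := Mp w; exists b; split=> //.
rewrite -ab; split=> [[F [A [bF -> /(encode_accepts A bF)]]]|aw] //.
have [F [A [bF Ew]]] := accepts_encode aw; exists F, A; split=> //.
by apply/(encode_accepts A bF); rewrite -Ew.
Qed.
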